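(* Let $\alpha\ge\beta>0$, and let $\boldsymbol{\mathscr{M}}=\mathbf{u}^{(1)}\circ\cdots\circ\mathbf{u}^{(N)}\in\mathcal{S}_1(\beta,\alpha)$ be an $N$-way $I\times\cdots\times I$ tensor. Let $\boldsymbol{\mathscr{X}}\sim\mathrm{Poisson}(\boldsymbol{\mathscr{M}})$, and let $\boldsymbol\theta\in\mathbb{R}^{NI}$ be the concatenation of the factors $\mathbf{u}^{(1)},\dots,\mathbf{u}^{(N)}$. Then the Fisher information matrix $\mathcal{I}_{\boldsymbol\theta}$ satisfies $$\mathrm{tr}\big(\mathcal{I}_{\boldsymbol\theta}^{\dagger}\big)=\mathcal{O}\Big(\frac{1}{I^{N-2}}\Big).$$ Furthermore, let $\widetilde{\boldsymbol{\mathscr{M}}}_1=\widetilde{\mathbf{u}}^{(1)}\circ\cdots\circ\widetilde{\mathbf{u}}^{(N)}$ be the shifted-Poisson estimator $$\widetilde{\boldsymbol{\mathscr{M}}}_1=\operatorname*{argmax}_{\boldsymbol{\mathscr{T}}\in\mathcal{S}_1(\beta,\alpha)}\ \sum_{\mathbf{i}}(x_{\mathbf{i}}+1)\log(t_{\mathbf{i}}+1)-(t_{\mathbf{i}}+1),$$ where the factors of $\boldsymbol{\mathscr{M}}$ and of $\widetilde{\boldsymbol{\mathscr{M}}}_1$ are scaled such that $\|\mathbf{u}^{(1)}\|_2=\cdots=\|\mathbf{u}^{(N)}\|_2$ and $\|\widetilde{\mathbf{u}}^{(1)}\|_2=\cdots=\|\widetilde{\mathbf{u}}^{(N)}\|_2$,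 and let $\boldsymbol\theta,\widetilde{\boldsymbol\theta}\in\mathbb{R}^{NI}$ be the corresponding concatenations of the scaled factors. There exist absolute constants $C_1,C_3>0$ such that if $I$ is large enough in the sense that $$IN^3\log^2(I)\ \ge\ \frac{(\beta^N+1)^2\beta^{2(N-1)}(\alpha-\beta)^2}{C_3(\alpha^N+1)^4}\qquad\text{and}\qquad C_1 I\log(N)\ge\log(I),$$ then $$\mathbb{E}\big\|\widetilde{\boldsymbol\theta}-\boldsymbol\theta\big\|_2^2=\mathcal{O}\Big(\frac{\log^2(I)}{I^{N-2}}\Big).$$ Here all quantities not involving $I$ (namely $N$, $\alpha$, $\beta$ and absolute constants) are treated as constants, i.e. the constants implied by $\mathcal{O}$ depend only on $N,\alpha,\beta$.
   Context: $\circ$ denotes the vector outer product; for a multi-index $\mathbf{i}=(i_1,\dots,i_N)\in\{1,\dots,I\}^N$ the entry of $\mathbf{w}^{(1)}\circ\cdots\circ\mathbf{w}^{(N)}$ is $w^{(1)}_{i_1}\cdots w^{(N)}_{i_N}$. The entries of $\boldsymbol{\mathscr{M}},\boldsymbol{\mathscr{X}},\boldsymbol{\mathscr{T}}$ are $m_{\mathbf{i}},x_{\mathbf{i}},t_{\mathbf{i}}$. The search space is $\mathcal{S}_1(\beta,\alpha)=\{\boldsymbol{\mathscr{T}}=\mathbf{w}^{(1)}\circ\cdots\circ\mathbf{w}^{(N)}\ |\ \mathbf{w}^{(n)}\in[\beta,\alpha]^I,\ n=1,\dots,N\}$. $\boldsymbol{\mathscr{X}}\sim\mathrm{Poisson}(\boldsymbol{\mathscr{M}})$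 means that the entries $x_{\mathbf{i}}$ are independent with $\mathbb{P}(x_{\mathbf{i}}=k)=m_{\mathbf{i}}^k e^{-m_{\mathbf{i}}}/k!$ for every $k\in\mathbb{N}$ (including $k=0$). With $f(\boldsymbol{\mathscr{X}};\boldsymbol\theta)$ the resulting joint probability mass function as a function of the concatenated factors $\boldsymbol\theta$ (through $m_{\mathbf{i}}=u^{(1)}_{i_1}\cdots u^{(N)}_{i_N}$), the Fisher information matrix is $\mathcal{I}_{\boldsymbol\theta}=\mathbb{E}\big[\frac{\partial\log f}{\partial\boldsymbol\theta}\big(\frac{\partial\log f}{\partial\boldsymbol\theta}\big)^{\top}\big]\in\mathbb{R}^{NI\times NI}$, and $\dagger$ is the pseudo-inverse. The rescaling of the factors is by positive scalars that leave the tensor unchanged (so the scaled factors have positive entries). Expectations are over $\boldsymbol{\mathscr{X}}$. *)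

(* Defs.v *)
From HB Require Import structures.
From mathcomp Require Import all_boot all_order all_algebra.
From mathcomp Require Import all_classical all_reals all_analysis.

Set Implicit Arguments.
Unset Strict Implicit.
Unset Printing Implicit Defensive.
Import Order.TTheory GRing.Theory Num.Theory.
Import numFieldNormedType.Exports.

Local Open Scope classical_set_scope.
Local Open Scope ring_scope.

Definition norm2 (R : rcfType) (n : nat) (v : 'rV[R]_n) : R :=
  Num.sqrt (\sum_j v 0 j ^+ 2).

(* The four Penrose equations (real case). *)
Definition is_pseudo_inverse (R : realFieldType) (m n : nat)
    (A : 'M[R]_(m, n)) (G : 'M[R]_(n, m)) : Prop :=
  [/\ A *m G *m A = A, G *m A *m G = G,
      (A *m G)^T = A *m G & (G *m A)^T = G *m A].

(* Moore-Penrose inverse, computed from the full-rank factorization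
   A = C *m B with C = col_base A and B = row_base A. The library's pinvmx is
   not suitable: it is a generalized inverse that violates the symmetry
   equations. *)
Definition pseudo_inverse (R : realFieldType) (m n : nat) (A : 'M[R]_(m, n)) :
    'M[R]_(n, m) :=
  let C := col_base A in
  let B := row_base A in
  B^T *m invmx (B *m B^T) *m (invmx (C^T *m C) *m C^T).

Lemma row_free_gram_unit (R : realFieldType) (m n : nat) (B : 'M[R]_(m, n)) :
  row_free B -> B *m B^T \in unitmx.
Proof.
move=> Bfree; rewrite -row_free_unit -kermx_eq0.
have gram0 (y : 'rV[R]_n) : y *m y^T = 0 -> y = 0.
  move=> /matrixP/(_ 0 0); rewrite !mxE => /eqP.
  under eq_bigr do rewrite mxE -expr2.
  rewrite psumr_eq0 => [/allP y0|j _]; last exact: sqr_ge0.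
  apply/rowP => j; rewrite mxE.
  by have := y0 j (mem_index_enum _); rewrite sqrf_eq0 => /eqP.
apply/eqP/row_matrixP => i; rewrite row0; set v := row i _.
have vBB : v *m (B *m B^T) = 0 by rewrite /v -row_mul mulmx_ker row0.
apply: (row_free_inj Bfree); rewrite mul0mx; apply: gram0.
by rewrite trmx_mul mulmxA -(mulmxA v) vBB mul0mx.
Qed.

Lemma full_rank_pseudo_inverse (R : realFieldType) (m n r : nat)
    (C : 'M[R]_(m, r)) (B : 'M[R]_(r, n)) :
  C^T *m C \in unitmx -> B *m B^T \in unitmx ->
  is_pseudo_inverse (C *m B)
    (B^T *m invmx (B *m B^T) *m (invmx (C^T *m C) *m C^T)).
Proof.
move=> CC BB; set G := _ *m (_ *m C^T).
have AG : C *m B *m G = C *m invmx (C^T *m C) *m C^T.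
  by rewrite /G -!mulmxA; congr (C *m _); rewrite (mulmxA B) mulKVmx.
have GA : G *m (C *m B) = B^T *m invmx (B *m B^T) *m B.
  rewrite /G -!mulmxA; congr (_ *m (_ *m _)).
  by rewrite (mulmxA C^T) mulKmx.
split.
- by rewrite AG -!mulmxA (mulmxA C^T) mulKmx.
- by rewrite GA /G -!mulmxA (mulmxA B) mulKVmx.
- by rewrite AG !trmx_mul trmxK trmx_inv trmx_mul trmxK mulmxA.
- by rewrite GA !trmx_mul trmxK trmx_inv trmx_mul trmxK mulmxA.
Qed.

Lemma pseudo_inverseP (R : realFieldType) (m n : nat) (A : 'M[R]_(m, n)) :
  is_pseudo_inverse A (pseudo_inverse A).
Proof.
have := @full_rank_pseudo_inverse R m n _ (col_base A) (row_base A).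
rewrite mulmx_base; apply; last exact/row_free_gram_unit/row_base_free.
rewrite -[X in _ *m X]trmxK; apply: row_free_gram_unit.
by rewrite /row_free mxrank_tr; exact: col_base_full.
Qed.

Lemma pseudo_inverse_unique (R : realFieldType) (m n : nat) (A : 'M[R]_(m, n))
    (G : 'M[R]_(n, m)) :
  is_pseudo_inverse A G -> G = pseudo_inverse A.
Proof.
move: (pseudo_inverseP A); set H := pseudo_inverse A.
move=> [H1 H2 H3 H4] [G1 G2 G3 G4].
have AGH : A *m G = A *m H.
  by rewrite -G3 -{1}H1 -(mulmxA (A *m H)) trmx_mul G3 H3 mulmxA G1.
have GAH : G *m A = H *m A.
  rewrite -G4 -{1}H1 -(mulmxA A) (mulmxA G) trmx_mul G4 H4.
  by rewrite -mulmxA (mulmxA A) G1.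
by rewrite -G2 -mulmxA AGH mulmxA GAH H2.
Qed.

Definition multi_index (N I : nat) := {ffun 'I_N -> 'I_I}.

Definition tensor (T : Type) (N I : nat) := {ffun multi_index N I -> T}.

(* N factors in R^I are stored as the rows of an N x I matrix u; the
   concatenation of the factors in R^{NI} is then mxvec u (row-major). *)
Definition outer (R : comPzRingType) (N I : nat) (u : 'M[R]_(N, I)) :
    tensor R N I :=
  [ffun i : multi_index N I => \prod_n u n (i n)].

Definition in_box (R : numDomainType) (N I : nat) (beta alpha : R)
    (u : 'M[R]_(N, I)) : Prop :=
  forall n i, beta <= u n i <= alpha.

Definition search_space (R : numDomainType) (N I : nat) (beta alpha : R) :
    set (tensor R N I) :=
  [set T | exists2 w : 'M[R]_(N, I), in_box beta alpha w & T = outer w].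

Definition balanced_rescaling (R : rcfType) (N I : nat) (u v : 'M[R]_(N, I)) :
    Prop :=
  [/\ exists2 c : 'I_N -> R, (forall n, 0 < c n) &
        (forall n, row n v = c n *: row n u),
      outer v = outer u &
      forall n n', norm2 (row n v) = norm2 (row n' v)].

Section Probability.
Context {d : measure_display} {Omega : measurableType d} {R : realType}.
Context (P : probability Omega R) (N I : nat).
Implicit Types X : multi_index N I -> {RV P >-> nat}.

(* The B i can be taken to be setT, so this is the product rule for every
   subfamily. *)
Definition mutually_independent X : Prop :=
  forall B : multi_index N I -> set nat,
    P [set w | forall i, B i (X i w)] =
    (\prod_i P [set w | B i (X i w)])%E.

(* poisson_pmf m k is m ^+ k * e^-m / k! for m > 0; only positive rates are
   used here. *)
Definition poisson_tensor X (M : tensor R N I) : Prop :=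
  mutually_independent X /\
  forall i k, P [set w | X i w = k] = (poisson_pmf (M i) k)%:E.

Definition observed X (w : Omega) : tensor nat N I :=
  [ffun i : multi_index N I => X i w].

Definition joint_pmf (x : tensor nat N I) (theta : 'rV[R]_(N * I)) : R :=
  \prod_i poisson_pmf (outer (vec_mx theta) i) (x i).

Definition score (x : tensor nat N I) (theta : 'rV[R]_(N * I)) :
    'cV[R]_(N * I) :=
  \col_j 'D_(delta_mx 0 j) (fun t => ln (joint_pmf x t)) theta.

(* Expectations of quadratic polynomials in the counts: finite under a Poisson
   law, so fine is harmless. *)
Definition fisher_information X (theta : 'rV[R]_(N * I)) : 'M[R]_(N * I) :=
  \matrix_(j, k) fine 'E_P[fun w : Omega =>
    (score (observed X w) theta *m (score (observed X w) theta)^T) j k].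

End Probability.

Definition shifted_poisson_objective (R : realType) (N I : nat)
    (x : tensor nat N I) (T : tensor R N I) : R :=
  \sum_i (((x i)%:R + 1) * ln (T i + 1) - (T i + 1)).

Definition is_shifted_poisson_estimate (R : realType) (N I : nat)
    (beta alpha : R) (x : tensor nat N I) (T : tensor R N I) : Prop :=
  search_space beta alpha T /\
  forall T', search_space beta alpha T' ->
    shifted_poisson_objective x T' <= shifted_poisson_objective x T.

(* Main.v *)
Require Import Defs.
From HB Require Import structures.
From mathcomp Require Import all_boot all_order all_algebra.
From mathcomp Require Import all_classical all_reals all_analysis.
From mathcomp Require Import measurable_realfun ring lra.

Set Implicit Arguments.
Unset Strict Implicit.
Unset Printing Implicit Defensive.
Import Order.TTheory GRing.Theory Num.Theory.
Import numFieldNormedType.Exports.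

(** Write m for the entries of the true tensor and x for the observed counts.

    Fisher information. A multi-index i meets each mode once, so moving the
    entry a of factor n by h multiplies m_i by 1 + h [i_n = a] / u^n_a. The
    score is therefore the sum over i of (x_i - m_i) phi_i with
    phi_i(n, a) = [i_n = a] / u^n_a, and as independent Poisson counts have
    covariance matrix diag(m), the Fisher information F is the sum of
    m_i phi_i phi_i^T. Its entries are explicit in the row totals of u
    ([fisher_entry]). For N >= 2 F is singular, because the tensor does not see
    opposite rescalings of two factors, but a positive diagonal matrix minus a
    rank-one term gives an explicit H with F H F = F ([fisher_ginvP]). If Q is
    the orthogonal projection onto the range of F, the pseudo-inverse is Q H Q,
    of trace tr(H Q); the entries of Q are at most 1 in absolute value, so the
    trace is at most the sum of the |H_jk|, of order I^2 / I^N
    ([norm_trace_pseudo_inverse_le]).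

    Estimator. Let T be the estimate and M the truth. Comparing their
    objectives, and using log z <= 2 (sqrt z - 1) to make the expected loss
    quadratic, gives c |T - M|^2 <= sum_i h_i (x_i - m_i), where
    h_i = log (t_i + 1) - log (m_i + 1) ([basic_inequality]). T depends on x,
    so the right-hand side has to be controlled for all T at once. Rounding
    the factors of T to I^N steps changes it by a bounded amount in mean. For
    a rounded tensor, with Z = sum_i h_i (x_i - m_i), the Poisson generating
    function shows that exp (l Z - 2 l^2 alpha^N |h|^2) has mean at most 1
    ([exp_deviation_mean]); and as |h| <= |T - M|, a small constant l lets the
    quadratic left-hand side absorb the compensator. Summing over all rounded
    factors costs the logarithm of their number, N I log (I^N + 1), so
    E |T - M|^2 = O(I log I) ([loss_le_risk_bound], [has_mean_risk_bound]).

    Finally, summing a tensor over all modes but n recovers its factor n up to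
    a scalar, and equal norms of the factors determine the scalars; this turns
    an error on the tensor into an error on the balanced factors and gains a
    power I^(N-1) ([factor_error_le]). For I = 1 the assumed lower bound on I
    forces alpha = beta: the search space is then a single tensor and the
    estimation error vanishes. For I >= 2 one logarithm is to spare, and it
    absorbs the bounded terms. *)

Local Open Scope classical_set_scope.
Local Open Scope ring_scope.

(** * Expectations of functions of independent counts *)
Section Observations.
Context {d : measure_display} {Omega : measurableType d} {R : realType}.
Context (P : probability Omega R) (N I : nat).
Context (X : multi_index N I -> {RV P >-> nat}).

Lemma measurable_event (B : multi_index N I -> set nat) :
  measurable [set w | forall i, B i (X i w)].
Proof.
have -> : [set w | forall i, B i (X i w)] =
    \bigcap_(i in [set: multi_index N I]) (X i @^-1` B i).
  by apply/seteqP; split => w /= h i; [move=> _|]; exact: h.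
apply: fin_bigcap_measurable => [|i _]; first exact: finite_finset.
by rewrite -[X in measurable X]setTI; exact: measurable_funP.
Qed.

(** The observed tensor takes countably many values, each on a measurable
    event, so any function of it is measurable. *)
Lemma measurable_observed (f : tensor nat N I -> R) :
  measurable_fun setT (fun w => f (observed X w)).
Proof.
move=> _ B mB; rewrite setTI.
pose E (x : tensor nat N I) :=
  [set w | B (f x) /\ forall i, X i w = x i].
have -> : (fun w => f (observed X w)) @^-1` B = \bigcup_x E x.
  apply/seteqP; split => [w /= Bw|w /= [x _ [Bx Xx]]].
    by exists (observed X w) => //; split => // i; rewrite ffunE.
  suff -> : observed X w = x by [].
  by apply/ffunP => i; rewrite ffunE Xx.
apply: countable_bigcupT_measurable => [|x].
  exact: (@countableP {ffun {ffun 'I_N -> 'I_I} -> nat}).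
have [Bx|nBx] := pselect (B (f x)); last first.
  by rewrite (_ : E x = set0)//; apply/seteqP; split => // w [].
rewrite (_ : E x = [set w | forall i, [set x i] (X i w)]).
  exact: (measurable_event (fun i => [set x i])).
by apply/seteqP; split => w /=; [case|].
Qed.

(** Integrability is bundled with the value, so that means pass through linear
    combinations without side conditions. *)
Definition has_mean (g : Omega -> R) (v : R) :=
  P.-integrable setT (EFin \o g) /\ (\int[P]_w (g w)%:E = v%:E)%E.

Lemma has_mean_eq g g' v v' : has_mean g v -> g =1 g' -> v = v' ->
  has_mean g' v'.
Proof. by move=> + /funext <- <-. Qed.

Lemma has_meanD g h v w : has_mean g v -> has_mean h w ->
  has_mean (fun t => g t + h t) (v + w).
Proof.
move=> [ig Eg] [ih Eh]; split; first exact: (integrableD _ ig ih).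
by under eq_integral do rewrite EFinD; rewrite integralD// Eg Eh EFinD.
Qed.

Lemma has_meanZ k g v : has_mean g v -> has_mean (fun t => k * g t) (k * v).
Proof.
move=> [ig Eg]; split; first exact: (integrableZl measurableT k ig).
by under eq_integral do rewrite EFinM; rewrite integralZl// Eg EFinM.
Qed.

Lemma has_mean_cst k : has_mean (fun=> k) k.
Proof.
split; first exact: finite_measure_integrable_cst.
by rewrite /= integral_cst//= probability_setT mule1.
Qed.

Lemma has_mean_sum (J : Type) (s : seq J) (g : J -> Omega -> R) (v : J -> R) :
  (forall j, has_mean (g j) (v j)) ->
  has_mean (fun t => \sum_(j <- s) g j t) (\sum_(j <- s) v j).
Proof.
move=> gv; elim: s => [|j s ih].
  by apply: has_mean_eq (has_mean_cst 0) _ _ => [t|]; rewrite big_nil.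
apply: has_mean_eq (has_meanD (gv j) ih) _ _ => [t|]; by rewrite big_cons.
Qed.

Context (p : multi_index N I -> nat -> R).
Hypothesis indep : mutually_independent X.
Hypothesis lawX : forall i k, P [set w | X i w = k] = (p i k)%:E.

(** When all counts are cut off below n the expectation is a finite sum over
    tensors; independence factors each term, and distributivity turns the sum
    of products into a product of sums. Monotone convergence removes the
    cutoff. *)
Lemma has_mean_prod (a : multi_index N I -> nat -> R)
    (A : multi_index N I -> R) :
  (forall i k, 0 <= a i k) ->
  (forall i, (fun n => \sum_(k < n) a i k * p i k) @ \oo --> A i) ->
  has_mean (fun w => \prod_i a i (X i w)) (\prod_i A i).
Proof.
move=> a0 aA.
pose f w := \prod_i a i (X i w).
have f0 w : 0 <= f w by apply: prodr_ge0.
pose E n (x : {ffun multi_index N I -> 'I_n}) :=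
  [set w | forall i, X i w = x i].
have mE n x : measurable (@E n x).
  exact: (measurable_event (fun i => [set nat_of_ord (x i)])).
pose g n w := f w * [forall i, X i w < n]%N%:R.
pose gsum n w := \sum_(x : {ffun multi_index N I -> 'I_n})
  (\prod_i a i (x i)) * \1_(@E n x) w.
have gE n w : g n w = gsum n w.
  rewrite /g /gsum; case: forallP => [lt|nlt]; last first.
    rewrite mulr0 big1// => x _; rewrite indicE memNset ?mulr0// => Ex.
    by apply: nlt => i; rewrite Ex ltn_ord.
  rewrite /= mulr1; pose x0 := [ffun i => Ordinal (lt i)].
  rewrite (bigD1 x0)//= [X in _ + X]big1 ?addr0 => [|x xx0].
    rewrite indicE mem_set /= ?mulr1 /f; last by move=> i; rewrite ffunE.
    by apply: eq_bigr => i _; rewrite ffunE.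
  rewrite indicE memNset ?mulr0// => Ex; case/negP: xx0; apply/eqP/ffunP => i.
  by apply/val_inj; rewrite /= ffunE /= Ex.
have mg n : measurable_fun setT (g n).
  rewrite (_ : g n = gsum n).
    apply: measurable_sum => x; exact: measurable_funM.
  by apply/funext => w; exact: gE.
have g0 n w : 0 <= g n w by rewrite mulr_ge0.
have gint n : (\int[P]_w (g n w)%:E =
    (\prod_i \sum_(k < n) a i k * p i k)%:E)%E.
  under eq_integral do rewrite gE /gsum -sumEFin.
  rewrite ge0_integral_sum//; first last.
  - by move=> x w _; rewrite lee_fin mulr_ge0// prodr_ge0.
  - move=> x; apply/measurable_EFinP; exact: measurable_funM.
  rewrite bigA_distr_bigA -sumEFin; apply: eq_bigr => x _.
  under eq_integral do rewrite EFinM.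
  rewrite ge0_integralZl//; last by rewrite lee_fin prodr_ge0.
  - rewrite integral_indic// setIT big_split EFinM; congr (_ * _)%E.
    apply: (etrans (indep (fun i => [set nat_of_ord (x i)]))).
    by rewrite -prodEFin; apply: eq_bigr => i _; exact: lawX.
  - by apply/measurable_EFinP; exact: measurable_indic.
have gf w : (fun n => (g n w)%:E) @ \oo --> (f w)%:E.
  apply: cvg_near_cst; near=> k; congr _%:E; rewrite /g.
  suff -> : [forall i, X i w < k]%N by rewrite mulr1.
  apply/forallP => i; apply: (leq_ltn_trans (@leq_bigmax _ (X ^~ w) i)).
  by near: k; exact: nbhs_infty_gt.
have := @cvg_monotone_convergence _ _ _ P _ measurableT
  (fun n w => (g n w)%:E).
move=> /(_ (fun n => (measurable_EFinP _ _).2 (mg n))).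
move=> /(_ (fun n w _ => g0 n w)) H.
have {}H : (\int[P]_w (g n w)%:E)%E @[n --> \oo] --> (\int[P]_w (f w)%:E)%E.
  rewrite (_ : (\int[P]_w (f w)%:E)%E =
    (\int[P]_w (limn (fun n => (g n w)%:E)))%E).
    apply: H => w _ n m nm; rewrite lee_fin /g ler_wpM2l// ler_nat.
    case: (boolP [forall i, (X i w < n)%N]) => // /forallP lt.
    by rewrite lt0b; apply/forallP => i; exact: leq_trans (lt i) nm.
  by apply: eq_integral => w _; apply/esym/cvg_lim => //; exact: gf.
have fint : (\int[P]_w (f w)%:E = (\prod_i A i)%:E)%E.
  apply: (cvg_unique _ H) => //.
  rewrite (_ : (fun n => _) =
      fun n => (\prod_i \sum_(k < n) a i k * p i k)%:E); last first.
    by apply/funext => n; exact: gint.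
  apply: cvg_EFin; first exact: nearW.
  rewrite (_ : _ \o _ = fun n => \prod_i \sum_(k < n) a i k * p i k)//.
  elim: (index_enum _) => [|i s ih].
    by under eq_fun do rewrite big_nil; rewrite big_nil; exact: cvg_cst.
  by under eq_fun do rewrite big_cons; rewrite big_cons; exact: cvgM.
split => //; apply/integrableP; split.
  apply/measurable_EFinP.
  pose F (x : tensor nat N I) := \prod_i a i (x i).
  rewrite -/f (_ : f = fun w => F (observed X w)).
    exact: measurable_observed.
  by apply/funext => w; apply: eq_bigr => i _; rewrite ffunE.
rewrite (eq_integral (fun w => (f w)%:E)) ?fint ?ltry// => w _.
by rewrite /= ger0_norm// f0.
Unshelve. all: by end_near. Qed.

End Observations.
(** * Moments and exponential moments of the Poisson law *)
Section PoissonSeries.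
Context {R : realType}.
Implicit Types (m z : R) (k n : nat).

Lemma cvg_poisson_pgf m z : 0 < m ->
  (fun n => \sum_(k < n) z ^+ k * poisson_pmf m k) @ \oo -->
    expR (m * (z - 1)).
Proof.
move=> m0; rewrite mulrBr mulr1 addrC expRD.
rewrite (_ : (fun n => _) = fun n => expR (- m) * series (exp_coeff (m * z)) n).
  by apply: cvgMr; exact: is_cvg_series_exp_coeff.
apply/funext => n; rewrite /series /= big_mkord mulr_sumr.
apply: eq_bigr => k _; rewrite /poisson_pmf m0 /exp_coeff /= exprMn.
ring.
Qed.

Lemma cvg_poisson_mass m : 0 < m ->
  (fun n => \sum_(k < n) poisson_pmf m k) @ \oo --> (1 : R).
Proof.
move=> m0; rewrite (_ : (fun n => _) =
    fun n => \sum_(k < n) 1 ^+ k * poisson_pmf m k); last first.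
  by apply/funext => n; apply: eq_bigr => k _; rewrite expr1n mul1r.
by have := @cvg_poisson_pgf m 1 m0; rewrite subrr mulr0 expR0.
Qed.

(** This shift reduces the moments to the total mass. *)
Lemma poisson_pmfS m k : 0 < m ->
  k.+1%:R * poisson_pmf m k.+1 = m * poisson_pmf m k.
Proof.
move=> m0; rewrite /poisson_pmf m0 factS natrM exprS invfM.
have k0 : k.+1%:R != 0 :> R by rewrite pnatr_eq0.
have f0 : k`!%:R != 0 :> R by rewrite pnatr_eq0 -lt0n fact_gt0.
by move: (k.+1%:R : R) (k`!%:R : R) k0 f0 => a b a0 b0; field; rewrite a0 b0.
Qed.

Lemma cvg_poisson_mean m : 0 < m ->
  (fun n => \sum_(k < n) k%:R * poisson_pmf m k) @ \oo --> m.
Proof.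
move=> m0; rewrite -cvg_shiftS.
rewrite (_ : (fun n => _) = fun n => m * \sum_(k < n) poisson_pmf m k).
  suff : (fun n => m * \sum_(k < n) poisson_pmf m k) @ \oo --> m * 1.
    by rewrite mulr1.
  by apply: cvgMr; exact: cvg_poisson_mass.
apply/funext => n; rewrite big_ord_recl mul0r add0r mulr_sumr.
by apply: eq_bigr => k _; rewrite poisson_pmfS.
Qed.

Lemma cvg_poisson_second_moment m : 0 < m ->
  (fun n => \sum_(k < n) k%:R ^+ 2 * poisson_pmf m k) @ \oo --> m ^+ 2 + m.
Proof.
move=> m0; rewrite -cvg_shiftS.
rewrite (_ : (fun n => _) = fun n => m * (\sum_(k < n) k%:R * poisson_pmf m k +
    \sum_(k < n) poisson_pmf m k)).
  rewrite (_ : _ + m = m * (m + 1)); last by ring.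
  apply: cvgMr.
  by apply: cvgD; [exact: cvg_poisson_mean|exact: cvg_poisson_mass].
apply/funext => n; rewrite big_ord_recl expr0n mul0r add0r mulrDr !mulr_sumr.
rewrite -big_split; apply: eq_bigr => k _ /=.
rewrite /bump /= add1n expr2 -mulrA poisson_pmfS//.
by rewrite -natr1; ring.
Qed.

(** As expR (- z) >= 1 - z, it suffices that
    (1 + z + 2 z^2) (1 - z) = 1 + z^2 (1 - 2 z) >= 1. *)
Lemma expR_le_quadratic z : z <= 2^-1 -> expR z <= 1 + z + 2 * z ^+ 2.
Proof.
move=> z2; have h1 : 0 < 1 - z by lra.
have h2 : expR z * (1 - z) <= 1.
  rewrite -[X in _ <= X](mulfV (lt0r_neq0 (expR_gt0 z))) ler_pM2l ?expR_gt0//.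
  by rewrite -expRN; exact: expR_ge1Dx.
have h3 : 1 <= (1 + z + 2 * z ^+ 2) * (1 - z).
  rewrite (_ : _ * _ = 1 + z ^+ 2 * (1 - 2 * z)); last by ring.
  by rewrite lerDl mulr_ge0 ?sqr_ge0//; lra.
by rewrite -(ler_pM2r h1); exact: le_trans h2 h3.
Qed.

End PoissonSeries.

Section PoissonTensor.
Context {d : measure_display} {Omega : measurableType d} {R : realType}.
Context (P : probability Omega R) (N I : nat).
Context (X : multi_index N I -> {RV P >-> nat}) (M : tensor R N I).
Hypothesis M_gt0 : forall i, 0 < M i.
Hypothesis PX : poisson_tensor X M.

Lemma has_mean_count_prod (e : multi_index N I -> nat)
    (A : multi_index N I -> R) :
  (forall i, (fun n => \sum_(k < n) k%:R ^+ e i * poisson_pmf (M i) k) @ \oo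
     --> A i) ->
  has_mean P (fun w => \prod_i (X i w)%:R ^+ e i) (\prod_i A i).
Proof.
case: PX => indep lawX eA.
by apply: (has_mean_prod indep lawX (a := fun i k => k%:R ^+ e i)) => // i k;
  exact: exprn_ge0.
Qed.

Lemma has_mean_count i : has_mean P (fun w => (X i w)%:R) (M i).
Proof.
have := @has_mean_count_prod (fun l => (l == i)%N)
  (fun l => if l == i then M i else 1).
move=> /(_ _) H; apply: has_mean_eq (H _) _ _ => [l|w|].
- case: eqP => [->|_] /=.
    by under eq_fun do under eq_bigr do rewrite expr1; exact: cvg_poisson_mean.
  under eq_fun do under eq_bigr do rewrite expr0 mul1r.
  exact: cvg_poisson_mass.
- by rewrite (bigD1 i)//= eqxx expr1 big1 ?mulr1// => l /negbTE ->.
- by rewrite (bigD1 i)//= eqxx big1 ?mulr1// => l /negbTE ->.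
Qed.

(** Both cases i = j and i <> j are one product over the multi-indices, with
    exponent [l = i] + [l = j] at l. *)
Lemma has_mean_count2 i j : has_mean P (fun w => (X i w)%:R * (X j w)%:R)
  (M i * M j + M i *+ (i == j)).
Proof.
pose A l := (if l == i then M i else 1) * (if l == j then M j else 1)
   + (if (i == j) && (l == i) then M i else 0).
have := @has_mean_count_prod (fun l => (l == i) + (l == j))%N A.
move=> /(_ _) H; apply: has_mean_eq (H _) _ _ => [l|w|].
- rewrite /A; have [-> | li] := eqVneq l i.
    have [<- | ij] := eqVneq i j; rewrite ?addr0 ?mulr1 /= -?expr2.
      exact: cvg_poisson_second_moment.
    under eq_fun do under eq_bigr do rewrite expr1.
    exact: cvg_poisson_mean.
  rewrite andbF addr0 mul1r; have [<- | lj] := eqVneq l j => /=.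
    by under eq_fun do under eq_bigr do rewrite expr1; exact: cvg_poisson_mean.
  under eq_fun do under eq_bigr do rewrite expr0 mul1r.
  exact: cvg_poisson_mass.
- under eq_bigr do rewrite exprD.
  rewrite big_split /=; congr (_ * _).
    by rewrite (bigD1 i)//= eqxx expr1 big1 ?mulr1// => l /negbTE ->.
  by rewrite (bigD1 j)//= eqxx expr1 big1 ?mulr1// => l /negbTE ->.
- have [E|ij] := eqVneq i j.
    rewrite -E (bigD1 i)//= big1 => [|l li].
      by rewrite /A -E eqxx /= mulr1.
    by rewrite /A -E (negbTE li) andbF addr0 mulr1.
  rewrite mulr0n addr0 (bigD1 i)//= (bigD1 j) 1?eq_sym//= big1 => [|l].
    by rewrite /A eqxx (negbTE ij) eq_sym (negbTE ij) !eqxx /= !addr0 !mulr1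
       mul1r.
  by rewrite /A => /andP[/negbTE -> /negbTE ->]; rewrite andbF addr0 mulr1.
Qed.

Lemma has_mean_cov i j :
  has_mean P (fun w => ((X i w)%:R - M i) * ((X j w)%:R - M j))
    (M i *+ (i == j)).
Proof.
have H := has_meanD (has_meanD (has_mean_count2 i j)
    (has_meanZ (- M i) (has_mean_count j)))
  (has_meanD (has_meanZ (- M j) (has_mean_count i))
    (has_mean_cst P (M i * M j))).
apply: has_mean_eq H _ _ => [w|]; last by move: (M i *+ _) => c; ring.
by rewrite /=; move: ((X i w)%:R : R) ((X j w)%:R : R) => x y; ring.
Qed.

Lemma has_mean_exp (y : multi_index N I -> R) :
  has_mean P (fun w => expR (\sum_i y i * ((X i w)%:R - M i)))
    (expR (\sum_i M i * (expR (y i) - 1 - y i))).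
Proof.
case: PX => indep lawX.
pose a i k := expR (y i * (k%:R - M i)) : R.
have H := has_mean_prod indep lawX (a := a)
  (A := fun i => expR (M i * (expR (y i) - 1 - y i))) (fun i k => expR_ge0 _).
apply: has_mean_eq (H _) _ _ => [i|w|]; last first.
- by rewrite expR_sum.
- by rewrite expR_sum.
rewrite (_ : (fun n => _) = fun n => expR (- (M i * y i)) *
    \sum_(k < n) expR (y i) ^+ k * poisson_pmf (M i) k).
  rewrite (_ : M i * (_ - y i) = - (M i * y i) + M i * (expR (y i) - 1));
    last by ring.
  by rewrite expRD; apply: cvgMr; exact: cvg_poisson_pgf.
apply/funext => n; rewrite mulr_sumr; apply: eq_bigr => k _.
rewrite mulrA; congr (_ * _); rewrite -expRM_natr -expRD /a; congr expR.
by ring.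
Qed.

End PoissonTensor.
(** * The score and the Fisher information *)
Section Score.
Context {R : realType} (N I : nat).
Implicit Types (u : 'M[R]_(N, I)) (x : tensor nat N I).

Lemma outer_gt0 u : (forall n a, 0 < u n a) -> forall i, 0 < outer u i.
Proof. by move=> u0 i; rewrite ffunE; apply: prodr_gt0. Qed.

(** A multi-index meets row n in a single entry, so each entry of the tensor is
    affine in each entry of the factors. *)
Lemma outer_perturb u n a h i : u n a != 0 ->
  outer (h *: delta_mx n a + u) i =
    outer u i * (1 + h * ((i n == a)%:R / u n a)).
Proof.
move=> una; rewrite !ffunE (bigD1 n)//= [in RHS](bigD1 n)//= mulrAC.
congr (_ * _); last first.
  by apply: eq_bigr => l /negbTE ln; rewrite !mxE ln mulr0 add0r.
rewrite !mxE eqxx; have [->|_] := eqVneq (i n) a; last first.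
  by rewrite mul0r !mulr0 add0r addr0 mulr1.
by rewrite /=; field.
Qed.

Lemma ln_poisson_pmf (m : R) k : 0 < m ->
  ln (poisson_pmf m k) = k%:R * ln m + (ln (k`!%:R^-1) - m).
Proof.
move=> m0; have f0 : 0 < k`!%:R^-1 :> R by rewrite invr_gt0 ltr0n fact_gt0.
rewrite /poisson_pmf m0 !lnM ?posrE ?mulr_gt0 ?exprn_gt0 ?expR_gt0//.
by rewrite lnXn// expRK mulr_natl addrA.
Qed.

Lemma poisson_pmf_gt0 (m : R) k : 0 < m -> 0 < poisson_pmf m k.
Proof.
by move=> m0; rewrite /poisson_pmf m0 !mulr_gt0 ?exprn_gt0 ?expR_gt0.
Qed.

Lemma ln_prod (J : Type) (s : seq J) (f : J -> R) : (forall j, 0 < f j) ->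
  ln (\prod_(j <- s) f j) = \sum_(j <- s) ln (f j).
Proof.
move=> f0; elim: s => [|j s ih]; first by rewrite !big_nil ln1.
by rewrite !big_cons lnM ?posrE ?prodr_gt0// ih.
Qed.

Lemma ln_joint_pmf x u : (forall i, 0 < outer u i) ->
  ln (joint_pmf x (mxvec u)) = \sum_i ((x i)%:R * ln (outer u i) +
    (ln ((x i)`!%:R^-1) - outer u i)).
Proof.
move=> u0; rewrite /joint_pmf mxvecK ln_prod => [|i].
  by apply: eq_bigr => i _; exact: ln_poisson_pmf.
exact: poisson_pmf_gt0.
Qed.

Lemma cvg_ln1D (c : R) : h^-1 * ln (1 + h * c) @[h --> 0^'] --> c.
Proof.
have H : is_derive (0 : R) 1 (@ln R \o (fun h : R => 1 + h * c)) (1^-1 * c).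
  apply: is_derive1_comp.
    by rewrite mul0r addr0; exact: is_derive1_ln.
  rewrite (_ : (fun h => _) = cst 1 + c *: id); last first.
    by apply/funext => h /=; rewrite mulrC.
  by rewrite -[c in is_derive _ _ _ c]mulr1 -[c * 1]add0r; exact: is_deriveD.
have [] := H; rewrite invr1 mul1r => H1 H2.
have := H1; rewrite /derivable => /cvg_ex[l Hl].
move: H2; rewrite /derive (cvg_lim _ Hl)// => lc; rewrite lc in Hl.
apply: cvg_trans Hl; apply: near_eq_cvg; apply: nearW => h /=.
by rewrite mul0r !addr0 ln1 subr0 [h *: 1]mulr1.
Qed.

(** By [outer_perturb] the difference quotient of the log-likelihood along a
    coordinate is a sum of terms ln (1 + h c) / h. *)
Lemma scoreE x u n a : (forall n a, 0 < u n a) ->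
  score x (mxvec u) (mxvec_index n a) 0 =
    \sum_(i : multi_index N I) ((i n == a)%:R / u n a) * ((x i)%:R - outer u i).
Proof.
move=> u0; have m0 := outer_gt0 u0; rewrite mxE.
have una : u n a != 0 by rewrite gt_eqF.
apply: cvg_lim => //.
pose c (i : multi_index N I) : R := (i n == a)%:R / u n a.
have H : (\sum_(i : multi_index N I)
      ((x i)%:R * (h^-1 * ln (1 + h * c i)) - outer u i * c i)) @[h --> 0^']
    --> \sum_(i : multi_index N I) ((x i)%:R * c i - outer u i * c i).
  apply: cvg_big => [|i _]; first exact: add_continuous.
  by apply: cvgB; [apply: cvgMr; exact: cvg_ln1D|exact: cvg_cst].
rewrite (eq_bigr _ (fun i _ => mulrBr (c i) _ _)).
under eq_bigr do rewrite ![c _ * _]mulrC.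
apply: cvg_trans H; apply: near_eq_cvg; near=> h.
have h0 : h != 0 by near: h; exact: nbhs_dnbhs_neq.
(* below this size of h every rate stays positive *)
have hu : `|h| < u n a by near: h; exact: dnbhs0_lt.
have hc i : 0 < 1 + h * c i.
  rewrite /c; case: eqP => _; rewrite ?mul0r ?mulr0 ?addr0// mul1r.
  rewrite -ltrBlDl sub0r ltr_pdivlMr// mulN1r.
  by rewrite ltrNl; apply: le_lt_trans hu; rewrite -normrN ler_norm.
have E : h *: delta_mx 0 (mxvec_index n a) + mxvec u =
    mxvec (h *: delta_mx n a + u).
  by rewrite linearD linearZ /= mxvec_delta.
rewrite /= E !ln_joint_pmf//; last first.
  by move=> i; rewrite outer_perturb//; exact: mulr_gt0 (m0 i) (hc i).
rewrite -sumrB scaler_sumr; apply: eq_bigr => i _.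
rewrite outer_perturb// -/(c i) lnM ?posrE//.
by rewrite /GRing.scale /=; field.
Unshelve. all: by end_near. Qed.

Context {d : measure_display} {Omega : measurableType d}.
Context (P : probability Omega R) (X : multi_index N I -> {RV P >-> nat}).

(** The score is linear in the centred counts, whose covariance matrix is the
    diagonal matrix of the rates. *)
Lemma fisher_informationE u n a n' b : (forall n a, 0 < u n a) ->
  poisson_tensor X (outer u) ->
  fisher_information X (mxvec u) (mxvec_index n a) (mxvec_index n' b) =
  \sum_(i : multi_index N I)
    outer u i * ((i n == a)%:R / u n a) * ((i n' == b)%:R / u n' b).
Proof.
move=> u0 PX; have m0 := outer_gt0 u0.
pose c n a (i : multi_index N I) : R := (i n == a)%:R / u n a.
have H := has_mean_sum (index_enum _) (fun i => has_mean_sum (index_enum _)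
  (fun j => has_meanZ (c n a i * c n' b j) (has_mean_cov m0 PX i j))).
rewrite mxE unlock.
rewrite (eq_integral (fun w => (\sum_(i : multi_index N I)
  \sum_(j : multi_index N I) c n a i * c n' b j *
  (((X i w)%:R - outer u i) * ((X j w)%:R - outer u j)))%:E)) => [|w _].
  rewrite (proj2 H) /=; apply: eq_bigr => i _.
  rewrite (bigD1 i)//= big1 => [|j /negbTE ji]; last first.
    by rewrite eq_sym ji mulr0.
  by rewrite eqxx addr0 /= mulr1n mulrC mulrA.
rewrite mxE big_ord1 [in X in _ * X]mxE !scoreE// big_distrlr /=.
congr _%:E; apply: eq_bigr => i _; apply: eq_bigr => j _.
by rewrite !ffunE mulrACA.
Qed.

End Score.
(** * Trace of a pseudo-inverse from a generalized inverse *)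
Section PseudoInverseTrace.
Context {R : realFieldType} (n : nat).
Implicit Types F G H : 'M[R]_n.

(** A diagonal entry of an orthogonal projection is the sum of the squares of
    its row, hence at most 1, and it dominates the square of each entry of that
    row. *)
Lemma normr_entry_sym_idempotent F j k : F^T = F -> F *m F = F -> `|F j k| <= 1.
Proof.
move=> FT FF.
have Fsq i : F i i = \sum_l F i l ^+ 2.
  rewrite -{1}FF mxE; apply: eq_bigr => l _.
  by rewrite expr2 -{2}FT mxE.
have sq0 i l : F i l ^+ 2 <= F i i.
  by rewrite [leRHS]Fsq (bigD1 l)//= lerDl sumr_ge0// => ? _; exact: sqr_ge0.
have diag1 i : F i i <= 1.
  have := sq0 i i; rewrite leNgt; apply: contraNle => h.
  by rewrite expr2 ltr_pMr// (lt_trans _ h).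
rewrite -(@expr_le1 _ 2)// real_normK ?num_real//.
exact: le_trans (sq0 j k) (diag1 j).
Qed.

(** With Q = F F^+ the orthogonal projection onto the range of F, the
    pseudo-inverse is Q H Q for any H such that F H F = F, so its trace is
    tr (H Q). A bound on the entries of one explicit H thus replaces a bound on
    the nonzero eigenvalues of F. *)
Lemma norm_trace_pseudo_inverse_le F H : F^T = F -> F *m H *m F = F ->
  `|\tr (pseudo_inverse F)| <= \sum_j \sum_k `|H j k|.
Proof.
move=> FT FHF; set G := pseudo_inverse F.
have [FGF GFG FGT GFT] := pseudo_inverseP F; rewrite -/G in FGF GFG FGT GFT.
have GT : G^T = G.
  apply: pseudo_inverse_unique; split.
  - by rewrite -{1 2}FT -!trmx_mul mulmxA FGF.
  - by rewrite -{1}FT -!trmx_mul mulmxA GFG.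
  - by rewrite -{1 2}FT -!trmx_mul GFT.
  - by rewrite -{1 2}FT -!trmx_mul FGT.
have GF : G *m F = F *m G by rewrite -GFT trmx_mul GT FT.
pose Q := F *m G.
have QQ : Q *m Q = Q by rewrite /Q mulmxA FGF.
have QT : Q^T = Q by [].
have GQHQ : G = Q *m H *m Q.
  transitivity (G *m (F *m H *m F) *m G); first by rewrite FHF GFG.
  by rewrite /Q -{1}GF !mulmxA.
have -> : \tr G = \tr (H *m Q).
  by rewrite {1}GQHQ mxtrace_mulC mulmxA QQ mxtrace_mulC.
rewrite /mxtrace (le_trans (ler_norm_sum _ _ _))//; apply: ler_sum => j _.
rewrite mxE (le_trans (ler_norm_sum _ _ _))//; apply: ler_sum => k _.
by rewrite normrM ler_piMr//; exact: normr_entry_sym_idempotent.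
Qed.

End PseudoInverseTrace.

(** * An explicit generalized inverse of the Fisher information *)
Section FisherTrace.
Context {R : realType} (N I : nat) (u : 'M[R]_(N, I)).
Hypothesis u_gt0 : forall n a, 0 < u n a.
Hypothesis I_gt0 : (0 < I)%N.

Definition row_total n := \sum_a u n a.
Definition tensor_total := \prod_n row_total n.

Lemma row_total_gt0 n : 0 < row_total n.
Proof.
rewrite /row_total (bigD1 (Ordinal I_gt0))//= ltr_pwDl// sumr_ge0// => a _.
exact: ltW.
Qed.

Lemma total_gt0 : 0 < tensor_total.
Proof. by apply: prodr_gt0 => n _; exact: row_total_gt0. Qed.

Lemma sum_outer_prod (f : 'I_N -> 'I_I -> R) :
  \sum_(i : multi_index N I) \prod_n f n (i n) = \prod_n \sum_a f n a.
Proof. by rewrite bigA_distr_bigA. Qed.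

(** The sum over i of m_i phi_i(n, a) phi_i(n', b) in closed form, with
    phi_i(n, a) = [i_n = a] / u^n_a. *)
Definition fisher_entry n a n' b : R :=
  tensor_total / (row_total n * row_total n') *
  (if n == n' then (a == b)%:R * row_total n / u n a else 1).

Lemma sum_fisher_entry n a n' b :
  \sum_(i : multi_index N I) outer u i * ((i n == a)%:R / u n a) *
     ((i n' == b)%:R / u n' b) = fisher_entry n a n' b.
Proof.
pose w l c : R := u l c * (if l == n then (c == a)%:R / u n a else 1) *
  (if l == n' then (c == b)%:R / u n' b else 1).
transitivity (\sum_(i : multi_index N I) \prod_l w l (i l)).
  apply: eq_bigr => i _; rewrite ffunE !big_split /=; congr (_ * _ * _).
    by rewrite (bigD1 n)//= eqxx big1 ?mulr1// => l /negbTE ->.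
  by rewrite (bigD1 n')//= eqxx big1 ?mulr1// => l /negbTE ->.
rewrite sum_outer_prod /fisher_entry /tensor_total.
have s0 l : row_total l != 0 by rewrite gt_eqF// row_total_gt0.
have u0 l c : u l c != 0 by rewrite gt_eqF.
have wrest l : l != n -> l != n' -> \sum_c w l c = row_total l.
  move=> /negbTE ln /negbTE ln'; apply: eq_bigr => c _.
  by rewrite /w ln ln' !mulr1.
have delta l c : \sum_e u l e * ((e == c)%:R / u l c) = 1.
  rewrite (bigD1 c)//= eqxx big1 => [|e /negbTE ->]; last first.
    by rewrite mul0r mulr0.
  by rewrite addr0 mul1r mulfV.
have [E|nn'] := eqVneq n n'.
  rewrite -E in w wrest *.
  rewrite (bigD1 n)//= [in RHS](bigD1 n)//= (eq_bigr row_total); last first.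
    by move=> l ln; rewrite wrest.
  have -> : \sum_c w n c = (a == b)%:R / u n a.
    rewrite (bigD1 a)//= big1 => [|c /negbTE ca]; last first.
      by rewrite /w eqxx ca mul0r mulr0 mul0r.
    rewrite /w !eqxx addr0 mul1r mulfV// mul1r.
    by case: eqP => [->//|_]; rewrite !mul0r.
  by move: (\prod_(_ | _) _) (_%:R : R) => p e; field; rewrite s0 u0.
have n'n : n' != n by rewrite eq_sym.
rewrite (bigD1 n)//= (bigD1 n')//= (eq_bigr row_total); last first.
  by move=> l /andP[ln ln']; rewrite wrest.
have -> : \sum_c w n c = 1.
  rewrite -(delta n a); apply: eq_bigr => c _.
  by rewrite /w eqxx (negbTE nn') mulr1.
have -> : \sum_c w n' c = 1.
  rewrite -(delta n' b); apply: eq_bigr => c _.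
  by rewrite /w eqxx (negbTE n'n) mulr1.
rewrite [in RHS](bigD1 n)//= [in RHS](bigD1 n')//=.
by move: (\prod_(_ | _) _) => p; field; rewrite !s0.
Qed.

Lemma sum_mxvec (f : 'I_(N * I) -> R) :
  \sum_k f k = \sum_n \sum_a f (mxvec_index n a).
Proof.
rewrite pair_big /= (reindex _ (curry_mxvec_bij _ _)) /=.
by apply: eq_bigr => -[].
Qed.

Context (F : 'M[R]_(N * I)).
Hypothesis FE : forall n a n' b,
  F (mxvec_index n a) (mxvec_index n' b) = fisher_entry n a n' b.

Lemma fisher_entryC n a n' b : fisher_entry n a n' b = fisher_entry n' b n a.
Proof.
rewrite /fisher_entry [in RHS]eq_sym [row_total n' * _]mulrC; congr (_ * _).
have [<-|//] := eqVneq n n'; rewrite eq_sym.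
by have [->|_] := eqVneq b a; rewrite // ?mul0r.
Qed.

Lemma fisher_sym : F^T = F.
Proof.
apply/matrixP => j k; rewrite mxE.
case/mxvec_indexP: j => n a; case/mxvec_indexP: k => n' b.
by rewrite !FE fisher_entryC.
Qed.

(** The result does not depend on n': a combination of the rows of u whose
    coefficients sum to 0 lies in the kernel of F. This is the scaling
    ambiguity of the factors. *)
Lemma fisher_contract n a n' :
  \sum_b u n' b * fisher_entry n a n' b = tensor_total / row_total n.
Proof.
have s0 l : row_total l != 0 by rewrite gt_eqF// row_total_gt0.
have u0 l c : u l c != 0 by rewrite gt_eqF.
rewrite /fisher_entry; have [<-|nn'] := eqVneq n n'.
  rewrite (bigD1 a)//= eqxx big1 => [|b /negbTE ba]; last first.
    by rewrite eq_sym ba !mul0r !mulr0.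
  by rewrite addr0 mul1r; field; rewrite s0 u0.
under eq_bigr do rewrite mulr1.
by rewrite -mulr_suml -/(row_total n'); field; rewrite !s0.
Qed.

(** Obtained by solving F z = y for y in the range of F; the kernel component
    of z is fixed by giving all rows of z, divided by the row totals of u, the
    same sum. *)
Definition fisher_ginv : 'M[R]_(N * I) :=
  diag_mx (mxvec (\matrix_(n, a) (u n a * row_total n / tensor_total))) -
  ((N%:R - 1) / (N%:R ^+ 2 * tensor_total)) *: ((mxvec u)^T *m mxvec u).

Lemma fisher_ginvP : (0 < N)%N -> F *m fisher_ginv *m F = F.
Proof.
move=> N0.
have s0 l : row_total l != 0 by rewrite gt_eqF// row_total_gt0.
have t0 : tensor_total != 0 by rewrite gt_eqF// total_gt0.
have u0 l c : u l c != 0 by rewrite gt_eqF.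
have n0 : N%:R != 0 :> R by rewrite pnatr_eq0 -lt0n.
rewrite /fisher_ginv mulmxBr mulmxBl -scalemxAr -scalemxAl.
set U := mxvec u.
have -> : F *m (U^T *m U) *m F = (F *m U^T) *m (F *m U^T)^T.
  by rewrite trmx_mul trmxK fisher_sym !mulmxA.
have FU n a k : (F *m U^T) (mxvec_index n a) k =
    N%:R * tensor_total / row_total n.
  rewrite mxE sum_mxvec.
  transitivity (\sum_l \sum_b u l b * fisher_entry n a l b).
    apply: eq_bigr => l _; apply: eq_bigr => b _.
    by rewrite mxE (ord1 k) mxvecE FE mulrC.
  under eq_bigr do rewrite fisher_contract.
  by rewrite sumr_const card_ord -mulrA mulr_natl.
apply/matrixP => j k.
case/mxvec_indexP: j => n a; case/mxvec_indexP: k => m b.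
rewrite [LHS]mxE [X in _ + X]mxE [X in _ - X]mxE [X in _ - _ * X]mxE big_ord1.
rewrite [(_^T) _ _]mxE !FU mul_mx_diag mxE sum_mxvec.
(* The diagonal part of H contributes F + (N - 1) t at this entry: block l = n
   gives the entry of F, each other block gives t. The rank-one part is
   scaled to cancel (N - 1) t. *)
pose t := tensor_total / (row_total n * row_total m).
have inner l : \sum_c fisher_entry n a l c *
    (u l c * row_total l / tensor_total) * fisher_entry l c m b =
    t + (fisher_entry n a m b - t) * (l == n)%:R.
  have [->|ln] := eqVneq l n.
    rewrite mulr1 addrC subrK (bigD1 a)//= big1 => [|c /negbTE ca]; last first.
      by rewrite /fisher_entry eqxx eq_sym ca !mul0r mulr0 !mul0r.
    rewrite {1}/fisher_entry !eqxx addr0 mul1r.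
    by move: (fisher_entry _ _ _ _) => e; field; rewrite t0 s0 u0.
  rewrite mulr0 addr0.
  transitivity (\sum_c (row_total n)^-1 * (u l c * fisher_entry m b l c)).
    apply: eq_bigr => c _.
    rewrite {1}/fisher_entry eq_sym (negbTE ln) mulr1.
    rewrite [in LHS]fisher_entryC.
    by move: (fisher_entry _ _ _ _) => e; field; rewrite t0 !s0.
  by rewrite -mulr_sumr fisher_contract /t; field; rewrite !s0.
under eq_bigr => l _.
  under eq_bigr do rewrite mxE !FE mxvecE mxE.
  rewrite inner; over.
rewrite big_split /= sumr_const card_ord -mulr_sumr.
rewrite (bigD1 n)//= eqxx big1 => [|l /negbTE ->//].
rewrite FE -[t *+ N]mulr_natl /t addr0 /= mulr1.
by move: (fisher_entry _ _ _ _) => e; field; rewrite n0 t0 !s0.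
Qed.

Lemma row_total_bounds (beta alpha : R) : in_box beta alpha u ->
  forall n, beta * I%:R <= row_total n <= alpha * I%:R.
Proof.
move=> box n; have cst (c : R) : c * I%:R = \sum_(a < I) c.
  by rewrite sumr_const card_ord mulr_natr.
by rewrite !cst; apply/andP; split; apply: ler_sum => a _;
  case/andP: (box n a).
Qed.

Lemma sum_norm_fisher_ginv_le (beta alpha : R) : (0 < N)%N -> 0 < beta ->
  in_box beta alpha u ->
  \sum_j \sum_k `|fisher_ginv j k| <=
    (2 * N%:R * alpha ^+ 2 / beta ^+ N) * (I%:R ^+ 2 / I%:R ^+ N).
Proof.
move=> N0 b0 box; have bnd := row_total_bounds box.
have i0 : 0 < I%:R :> R by rewrite ltr0n.
have n1 : 1 <= N%:R :> R by rewrite ler1n.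
have T0 := total_gt0.
have aI : 0 <= alpha * I%:R.
  apply: le_trans (ltW (row_total_gt0 (Ordinal N0))) _.
  by case/andP: (bnd (Ordinal N0)).
pose d : 'rV[R]_(N * I) :=
  mxvec (\matrix_(n, a) (u n a * row_total n / tensor_total)).
pose U := mxvec u; pose c : R := (N%:R - 1) / (N%:R ^+ 2 * tensor_total).
have c0 : 0 <= c.
  by rewrite divr_ge0 ?subr_ge0// mulr_ge0 ?exprn_ge0// ltW.
have U0 k : 0 <= U 0 k.
  by case/mxvec_indexP: k => n a; rewrite mxvecE ltW.
have d0 k : 0 <= d 0 k.
  case/mxvec_indexP: k => n a; rewrite mxvecE mxE.
  by rewrite !mulr_ge0 ?invr_ge0 ?(ltW T0) ?(ltW (row_total_gt0 n)) ?ltW.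
have le1 j k : `|fisher_ginv j k| <= d 0 j *+ (j == k) + c * (U 0 j * U 0 k).
  rewrite !mxE big_ord1 mxE -/d -/U -/c.
  apply: le_trans (ler_normB _ _) _.
  by rewrite (ger0_norm (mulrn_wge0 _ (d0 j)))
    (ger0_norm (mulr_ge0 c0 (mulr_ge0 (U0 j) (U0 k)))).
apply: (@le_trans _ _ (\sum_j d 0 j + c * (\sum_j U 0 j) ^+ 2)).
  rewrite expr2 mulr_suml mulr_sumr -big_split /=; apply: ler_sum => j _.
  apply: le_trans (ler_sum _ (fun k _ => le1 j k)) _.
  rewrite big_split /= (bigD1 j)//= eqxx big1 => [|k /negbTE kj]; last first.
    by rewrite eq_sym kj.
  by rewrite addr0 mulr1n -mulr_sumr -mulr_sumr.
have sd : \sum_j d 0 j <= N%:R * (alpha * I%:R) ^+ 2 / tensor_total.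
  rewrite sum_mxvec -mulrA -[N in leRHS]card_ord mulr_natl -sumr_const.
  apply: ler_sum => n _; under eq_bigr do rewrite mxvecE mxE -mulrA.
  rewrite -mulr_suml -/(row_total n) mulrA ler_wpM2r ?invr_ge0 ?(ltW T0)//.
  have /andP[_ h] := bnd n.
  by rewrite -expr2 lerXn2r// nnegrE// ltW// row_total_gt0.
have sU : \sum_j U 0 j <= N%:R * (alpha * I%:R).
  rewrite sum_mxvec -[N in leRHS]card_ord mulr_natl -sumr_const.
  apply: ler_sum => n _; under eq_bigr do rewrite mxvecE.
  by case/andP: (bnd n).
have sU0 : 0 <= \sum_j U 0 j by apply: sumr_ge0.
have Tge : (beta * I%:R) ^+ N <= tensor_total.
  rewrite -[N in leLHS]card_ord -prodr_const; apply: ler_prod => n _.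
  by case/andP: (bnd n) => ->; rewrite mulr_ge0// ltW.
have cU : c * (\sum_j U 0 j) ^+ 2 <= N%:R * (alpha * I%:R) ^+ 2 / tensor_total.
  apply: (@le_trans _ _ (c * (N%:R * (alpha * I%:R)) ^+ 2)).
    by rewrite ler_wpM2l// lerXn2r// nnegrE// (le_trans sU0).
  rewrite /c (_ : _ * _ =
      (N%:R - 1) * (alpha * I%:R) ^+ 2 / tensor_total); last first.
    by field; rewrite gt_eqF// gt_eqF// (lt_le_trans ltr01).
  rewrite ler_wpM2r ?invr_ge0 ?(ltW T0)// ler_wpM2r ?exprn_ge0//.
  by rewrite lerBlDr lerDl.
apply: le_trans (lerD sd cU) _.
rewrite -mulrDl -mulr2n -[_ *+ 2]mulr_natl.
apply: (@le_trans _ _ (2 * (N%:R * (alpha * I%:R) ^+ 2) / (beta * I%:R) ^+ N)).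
  apply: ler_wpM2l.
    by apply: mulr_ge0 => //; apply: mulr_ge0 => //; exact: exprn_ge0.
  by rewrite lef_pV2 ?posrE// exprn_gt0// mulr_gt0.
rewrite le_eqVlt; apply/orP; left; apply/eqP.
have bN : beta ^+ N != 0 by rewrite expf_neq0// gt_eqF.
have iN : I%:R ^+ N != 0 :> R by rewrite expf_neq0// gt_eqF.
rewrite !exprMn; move: (beta ^+ N) (I%:R ^+ N : R) bN iN => x y x0 y0.
by field; rewrite x0 y0.
Qed.

End FisherTrace.
(** * From tensors to balanced factors *)
Section BalancedFactors.
Context {R : realType} (N I : nat).
Implicit Types (p q u v : 'M[R]_(N, I)).

Lemma sqr_sum_weight_le (J : finType) (w f : J -> R) : (forall j, 0 <= w j) ->
  (\sum_j w j * f j) ^+ 2 <= (\sum_j w j) * \sum_j w j * f j ^+ 2.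
Proof.
move=> w0; set n := \sum_j w j; set S := \sum_j w j * f j.
have n0 : 0 <= n by apply: sumr_ge0.
have [n00|nn0] := eqVneq n 0.
  have wj0 j : w j = 0.
    apply/eqP; move/eqP: n00; rewrite psumr_eq0// => /allP/(_ j).
    by rewrite mem_index_enum => /(_ isT).
  rewrite n00 mul0r /S big1 ?expr0n// => j _; by rewrite wj0 mul0r.
have npos : 0 < n by rewrite lt_def nn0.
have : 0 <= \sum_j w j * (n * f j - S) ^+ 2.
  by apply: sumr_ge0 => j _; rewrite mulr_ge0// sqr_ge0.
have -> : \sum_j w j * (n * f j - S) ^+ 2 =
    n * (n * (\sum_j w j * f j ^+ 2) - S ^+ 2).
  transitivity (\sum_j (n ^+ 2 * (w j * f j ^+ 2) +
     ((- (2 * n * S)) * (w j * f j) + S ^+ 2 * w j))).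
    by apply: eq_bigr => j _; ring.
  rewrite !big_split /= -!mulr_sumr -/n -/S; ring.
by rewrite pmulr_rge0// subr_ge0.
Qed.

Definition dot p q n := \sum_a p n a * q n a.

Lemma norm2_row p n : norm2 (row n p) ^+ 2 = dot p p n.
Proof.
rewrite /norm2 sqr_sqrtr; last by apply: sumr_ge0 => a _; exact: sqr_ge0.
by apply: eq_bigr => a _; rewrite mxE expr2.
Qed.

Lemma dot_bounds p (b a : R) n : 0 < b -> in_box b a p ->
  b ^+ 2 * I%:R <= dot p p n <= a ^+ 2 * I%:R.
Proof.
move=> b0 bp; have cst (c : R) : c * I%:R = \sum_(k < I) c.
  by rewrite sumr_const card_ord mulr_natr.
rewrite !cst; apply/andP; split; apply: ler_sum => k _; rewrite -expr2;
  case/andP: (bp n k) => h1 h2;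
  by rewrite lerXn2r// nnegrE// (le_trans (ltW b0))// (le_trans h1).
Qed.

Lemma sum_outer_dot p q : \sum_i outer p i * outer q i = \prod_n dot p q n.
Proof.
rewrite -sum_outer_prod; apply: eq_bigr => i _.
by rewrite !ffunE -big_split.
Qed.

Lemma sum_outer_fiber p n a :
  \sum_(i : multi_index N I) (i n == a)%:R * outer p i =
  p n a * \prod_(l | l != n) row_total p l.
Proof.
pose f l c := p l c * (if l == n then (c == a)%:R else 1).
transitivity (\sum_(i : multi_index N I) \prod_l f l (i l)).
  apply: eq_bigr => i _; rewrite big_split /= ffunE mulrC; congr (_ * _).
  by rewrite [RHS](bigD1 n)//= eqxx big1 ?mulr1// => l /negbTE ->.
rewrite sum_outer_prod (bigD1 n)//=; congr (_ * _); last first.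
  by apply: eq_bigr => l /negbTE ln; apply: eq_bigr => c _; rewrite /f ln mulr1.
rewrite (bigD1 a)//= big1 => [|c /negbTE ca].
  by rewrite /f !eqxx mulr1 addr0.
by rewrite /f eqxx ca mulr0.
Qed.

Lemma sum_fiber n a :
  \sum_(i : multi_index N I) (i n == a)%:R = I%:R ^+ N.-1 :> R.
Proof.
have rt l : row_total (const_mx 1 : 'M[R]_(N, I)) l = I%:R.
  rewrite /row_total (eq_bigr (fun=> 1)) => [|c _]; last by rewrite mxE.
  by rewrite sumr_const card_ord.
have := sum_outer_fiber (const_mx 1) n a.
rewrite mxE mul1r => E; transitivity (\prod_(l < N | l != n) (I%:R : R)).
  rewrite (eq_bigr (row_total (const_mx 1 : 'M[R]_(N, I)))) ?rt// -E.
  by apply: eq_bigr => i _; rewrite ffunE big1 ?mulr1// => l _; rewrite mxE.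
by rewrite prodr_const cardC1 card_ord.
Qed.

(** Cauchy-Schwarz on each of the I fibres of mode n, which have I^(N-1)
    entries. *)
Lemma row_fiber_le p q n :
  \sum_a (p n a * \prod_(l | l != n) row_total p l -
          q n a * \prod_(l | l != n) row_total q l) ^+ 2 <=
  I%:R ^+ N.-1 * \sum_i (outer p i - outer q i) ^+ 2.
Proof.
have -> : \sum_i (outer p i - outer q i) ^+ 2 = \sum_a
    \sum_(i : multi_index N I) (i n == a)%:R * (outer p i - outer q i) ^+ 2.
  rewrite exchange_big /=; apply: eq_bigr => i _.
  by rewrite -mulr_suml (bigD1 (i n))//= eqxx big1 ?addr0 ?mul1r// => a /negbTE;
    rewrite eq_sym => ->.
rewrite mulr_sumr; apply: ler_sum => a _.
rewrite -(sum_fiber n a) -!sum_outer_fiber -sumrB.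
under eq_bigr do rewrite -mulrBr.
exact: sqr_sum_weight_le.
Qed.

(** Let r and s be the common norms of the rows of p and of q. The squared
    distance of the rows n is (r - s)^2 + 2 (r s - dot p q n). The second term
    measures the angle of the two rows; it is small because [row_fiber_le]
    makes row n of p close to a multiple of row n of q. The first term is small
    because the norms of the two tensors are r^N and s^N. *)
Lemma balanced_factors_le p q (b a : R) : (0 < N)%N -> (0 < I)%N -> 0 < b ->
  in_box b a p -> in_box b a q ->
  (forall n n', norm2 (row n p) = norm2 (row n' p)) ->
  (forall n n', norm2 (row n q) = norm2 (row n' q)) ->
  \sum_n \sum_c (p n c - q n c) ^+ 2 <=
    N%:R * (1 + 2 * a / b) / b ^+ (2 * N.-1) *
    ((\sum_i (outer p i - outer q i) ^+ 2) / I%:R ^+ N.-1).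
Proof.
move=> N0 I0 b0 bp bq np nq.
have i0 : 0 < I%:R :> R by rewrite ltr0n.
have [n0 _] : exists n0 : 'I_N, True by exists (Ordinal N0).
have p0 n c : 0 < p n c by apply: lt_le_trans b0 _; case/andP: (bp n c).
have q0 n c : 0 < q n c by apply: lt_le_trans b0 _; case/andP: (bq n c).
have a0 : 0 < a.
  by apply: lt_le_trans (p0 n0 (Ordinal I0)) _; case/andP: (bp n0 (Ordinal I0)).
pose r := norm2 (row n0 p); pose s := norm2 (row n0 q).
have rr n : dot p p n = r ^+ 2 by rewrite -norm2_row (np n n0).
have ss n : dot q q n = s ^+ 2 by rewrite -norm2_row (nq n n0).
have r_ge : b ^+ 2 * I%:R <= r ^+ 2.
  by rewrite -(rr n0); case/andP: (dot_bounds n0 b0 bp).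
have s_ge : b ^+ 2 * I%:R <= s ^+ 2.
  by rewrite -(ss n0); case/andP: (dot_bounds n0 b0 bq).
have s_le : s ^+ 2 <= a ^+ 2 * I%:R.
  by rewrite -(ss n0); case/andP: (dot_bounds n0 b0 bq).
have r0 : 0 < r.
  rewrite lt_def sqrtr_ge0 andbT; apply: contraTneq r_ge => ->.
  by rewrite expr0n /= -ltNge mulr_gt0// exprn_gt0.
have s0 : 0 < s.
  rewrite lt_def sqrtr_ge0 andbT; apply: contraTneq s_ge => ->.
  by rewrite expr0n /= -ltNge mulr_gt0// exprn_gt0.
have sr : s * b <= r * a.
  have sb0 : 0 <= s * b by rewrite mulr_ge0// ltW.
  have ra0 : 0 <= r * a by rewrite mulr_ge0// ltW.
  rewrite -(@ler_pXn2r _ 2)// !exprMn.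
  apply: (@le_trans _ _ (a ^+ 2 * I%:R * b ^+ 2)).
    by rewrite ler_wpM2r// exprn_ge0// ltW.
  by rewrite -mulrA mulrC ler_wpM2r ?exprn_ge0 ?(ltW a0)// mulrC.
set D := \sum_i (outer p i - outer q i) ^+ 2.
have D0 : 0 <= D by apply: sumr_ge0 => i _; exact: sqr_ge0.
pose J : R := I%:R ^+ N.-1.
have J0 : 0 < J by rewrite exprn_gt0.
pose eps := D / (b ^+ (2 * N.-1) * J).
have bJ0 : 0 < b ^+ (2 * N.-1) * J by rewrite mulr_gt0// exprn_gt0.
have eps0 : 0 <= eps by rewrite divr_ge0// ltW.
have t0 n : 0 <= dot p q n by apply: sumr_ge0 => c _; rewrite mulr_ge0// ltW.
have trs n : dot p q n <= r * s.
  have : 0 <= \sum_c (s * p n c - r * q n c) ^+ 2.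
    by apply: sumr_ge0 => c _; exact: sqr_ge0.
  have -> : \sum_c (s * p n c - r * q n c) ^+ 2 =
      2 * (r * s) * (r * s - dot p q n).
    transitivity (s ^+ 2 * dot p p n +
        (- (2 * r * s) * dot p q n + r ^+ 2 * dot q q n)).
      rewrite /dot !mulr_sumr -!big_split /=; apply: eq_bigr => c _; ring.
    by rewrite rr ss; ring.
  by rewrite pmulr_rge0 ?subr_ge0// !mulr_gt0.
have DE : D = (r ^+ 2) ^+ N + (s ^+ 2) ^+ N - 2 * \prod_n dot p q n.
  transitivity (\sum_i outer p i * outer p i + (\sum_i outer q i * outer q i +
      (-2) * \sum_i outer p i * outer q i)).
    by rewrite mulr_sumr -!big_split /=; apply: eq_bigr => i _; ring.
  rewrite !sum_outer_dot (eq_bigr _ (fun n _ => rr n)).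
  rewrite (eq_bigr _ (fun n _ => ss n)).
  rewrite !prodr_const card_ord; move: (\prod_n _) => x.
  by move: (_ ^+ N) (_ ^+ N) => y z; ring.
(* |outer p| = r^N and |outer q| = s^N differ by at most sqrt D, while
   r^N - s^N is r - s times a sum of positive terms, one of them r^(N-1) *)
have rs_le : (r - s) ^+ 2 <= eps.
  have h1 : (r ^+ N - s ^+ N) ^+ 2 <= D.
    rewrite DE (_ : _ ^+ 2 = (r ^+ 2) ^+ N + (s ^+ 2) ^+ N - 2 * (r * s) ^+ N).
      rewrite lerD2l lerN2 ler_wpM2l//.
      rewrite -[N in leRHS]card_ord -prodr_const; apply: ler_prod => n _.
      by rewrite t0 trs.
    rewrite [(r * s) ^+ N]exprMn [(r ^+ 2) ^+ N]exprAC [(s ^+ 2) ^+ N]exprAC.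
    by move: (r ^+ N) (s ^+ N) => x y; ring.
  have h2 : (r - s) ^+ 2 * (r ^+ 2) ^+ N.-1 <= (r ^+ N - s ^+ N) ^+ 2.
    rewrite subrXX [leRHS]exprMn ler_wpM2l ?sqr_ge0// exprAC.
    have r1 : 0 <= r ^+ N.-1 by rewrite exprn_ge0// ltW.
    have le1 : r ^+ N.-1 <= \sum_(i < N) r ^+ (N.-1 - i) * s ^+ i.
      rewrite (bigD1 (Ordinal N0))//= subn0 expr0 mulr1 lerDl sumr_ge0// => i _.
      by rewrite mulr_ge0// exprn_ge0// ltW.
    by rewrite lerXn2r// nnegrE// (le_trans r1).
  rewrite ler_pdivlMr//; apply: le_trans h1; apply: le_trans h2.
  rewrite ler_wpM2l ?sqr_ge0// exprM -exprMn lerXn2r// nnegrE ?sqr_ge0//.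
  by rewrite mulr_ge0 ?sqr_ge0 ?(ltW i0).
have row_le n : \sum_c (p n c - q n c) ^+ 2 <= (1 + 2 * a / b) * eps.
  pose A := \prod_(l | l != n) row_total p l.
  pose B := \prod_(l | l != n) row_total q l.
  have Age : b ^+ N.-1 * J <= A.
    rewrite -exprMn -[N in leLHS]card_ord -(cardC1 n) -prodr_const.
    apply: ler_prod => l _; rewrite mulr_ge0 ?(ltW b0) ?(ltW i0)//.
    by case/andP: (row_total_bounds bp l).
  have A0 : 0 < A by apply: lt_le_trans Age; rewrite mulr_gt0// exprn_gt0.
  (* row n of p is close to k times row n of q *)
  pose k := B / A.
  have h1 : \sum_c (p n c - k * q n c) ^+ 2 <= eps.
    have -> : \sum_c (p n c - k * q n c) ^+ 2 =
        A ^- 2 * \sum_c (p n c * A - q n c * B) ^+ 2.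
      rewrite mulr_sumr; apply: eq_bigr => c _; rewrite /k.
      by field; rewrite gt_eqF.
    apply: (@le_trans _ _ (A ^- 2 * (J * D))).
      by rewrite ler_wpM2l ?row_fiber_le// invr_ge0 exprn_ge0// ltW.
    have c0 : 0 < b ^+ N.-1 by rewrite exprn_gt0.
    have -> : eps = (b ^+ N.-1 * J) ^- 2 * (J * D).
      rewrite /eps mulnC exprM; move: (b ^+ N.-1) c0 => x x0.
      by field; rewrite !gt_eqF.
    apply: ler_wpM2r; first by rewrite mulr_ge0// ltW.
    rewrite lef_pV2 ?posrE ?exprn_gt0 ?mulr_gt0//.
    by rewrite lerXn2r// nnegrE ltW// mulr_gt0.
  (* s^2 |p_n - k q_n|^2 is smallest at k = <p_n, q_n> / s^2 *)
  have h2 : r ^+ 2 * s ^+ 2 - dot p q n ^+ 2 <= s ^+ 2 * eps.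
    apply: le_trans (ler_wpM2l (sqr_ge0 s) h1).
    have -> : \sum_c (p n c - k * q n c) ^+ 2 =
        r ^+ 2 - 2 * k * dot p q n + k ^+ 2 * s ^+ 2.
      transitivity (dot p p n + (- (2 * k) * dot p q n + k ^+ 2 * dot q q n)).
        rewrite /dot !mulr_sumr -!big_split /=; apply: eq_bigr => c _; ring.
      by rewrite rr ss; ring.
    have := sqr_ge0 (k * s ^+ 2 - dot p q n); nra.
  have h3 : r * s - dot p q n <= a / b * eps.
    clearbody eps.
    have [neg|pos] := leP (r * s - dot p q n) 0.
      by apply: le_trans neg _; rewrite mulr_ge0// divr_ge0// ltW.
    have h4 : (r * s - dot p q n) * r <= s * eps.
      rewrite -(ler_pM2l s0); apply: le_trans (_ : _ <= s ^+ 2 * eps) _.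
        apply: le_trans h2; move: (t0 n) pos; set t := dot p q n => t0n pos.
        have := mulr_ge0 t0n (ltW pos); nra.
      by rewrite (mulrA s s) -expr2.
    rewrite mulrAC ler_pdivlMr// -(ler_pM2l r0).
    apply: (@le_trans _ _ (s * eps * b)).
      by apply: le_trans (ler_wpM2r (ltW b0) h4); rewrite mulrA (mulrC r).
    by rewrite mulrAC mulrA ler_wpM2r.
  have -> : \sum_c (p n c - q n c) ^+ 2 =
      (r - s) ^+ 2 + 2 * (r * s - dot p q n).
    transitivity (dot p p n + (-2 * dot p q n + dot q q n)).
      rewrite /dot !mulr_sumr -!big_split /=; apply: eq_bigr => c _; ring.
    by rewrite rr ss; ring.
  rewrite (_ : (1 + 2 * a / b) * eps = eps + 2 * (a / b * eps)).
    by apply: lerD => //; rewrite ler_wpM2l.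
  by clearbody eps; ring.
apply: (@le_trans _ _ (\sum_(n < N) (1 + 2 * a / b) * eps)).
  by apply: ler_sum => n _; exact: row_le.
rewrite sumr_const card_ord -[_ *+ N]mulr_natl /eps -/D -/J.
rewrite le_eqVlt; apply/orP; left; apply/eqP.
have bN : b ^+ (2 * N.-1) != 0 by rewrite expf_neq0// gt_eqF.
move: (b ^+ (2 * N.-1)) bN => x x0.
by field; rewrite x0 !gt_eqF.
Qed.

End BalancedFactors.
(** * The basic inequality of the shifted Poisson objective *)
Section Deterministic.
Context {R : realType} (N I : nat).
Implicit Types (p q u v : 'M[R]_(N, I)) (x : tensor nat N I).

(** The scalars multiply to 1, so one of them is at most 1 and one is at least
    1. As the norms of the original rows agree up to a factor alpha / beta and
    those of the rescaled rows are equal, every scalar lies between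
    beta / alpha and alpha / beta. *)
Lemma balanced_rescaling_box u v (beta alpha : R) : (0 < N)%N -> (0 < I)%N ->
  0 < beta -> in_box beta alpha u -> balanced_rescaling u v ->
  in_box (beta ^+ 2 / alpha) (alpha ^+ 2 / beta) v.
Proof.
move=> N0 I0 b0 box [[c c0 vc] ovu nv].
have i0 : 0 < I%:R :> R by rewrite ltr0n.
have u0 n a : 0 < u n a by apply: lt_le_trans b0 _; case/andP: (box n a).
have a0 : 0 < alpha.
  apply: lt_le_trans (u0 (Ordinal N0) (Ordinal I0)) _.
  by case/andP: (box (Ordinal N0) (Ordinal I0)).
have vE n a : v n a = c n * u n a.
  by have /rowP/(_ a) := vc n; rewrite !mxE.
have c1 : \prod_n c n = 1.
  pose i0' : multi_index N I := [ffun=> Ordinal I0].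
  have /ffunP/(_ i0') := ovu; rewrite !ffunE.
  rewrite (eq_bigr (fun n => c n * u n (i0' n))) => [|n _]; last exact: vE.
  rewrite big_split /= => H.
  have u_neq0 : \prod_n u n (i0' n) != 0.
    by rewrite gt_eqF// prodr_gt0.
  by apply: (mulIf u_neq0); rewrite mul1r.
have cdot n m : c n ^+ 2 * dot u u n = c m ^+ 2 * dot u u m.
  have H l : dot v v l = c l ^+ 2 * dot u u l.
    by rewrite mulr_sumr; apply: eq_bigr => a _; rewrite vE; ring.
  by rewrite -!H -!norm2_row (nv n m).
have cmp n m (e : R) : c m <= e -> 0 <= e -> c n * beta <= e * alpha.
  move=> cme e0; have cb0 : 0 <= c n * beta by rewrite mulr_ge0// ltW.
  have ea0 : 0 <= e * alpha by rewrite mulr_ge0// ltW.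
  rewrite -(@ler_pXn2r _ 2)// -(ler_pM2r i0) !exprMn.
  rewrite -[leLHS]mulrA -[leRHS]mulrA.
  case/andP: (dot_bounds n b0 box) => h1 _.
  case/andP: (dot_bounds m b0 box) => _ h2.
  apply: le_trans (ler_wpM2l (sqr_ge0 (c n)) h1) _; rewrite (cdot n m).
  apply: le_trans (ler_wpM2l (sqr_ge0 (c m)) h2) _.
  apply: ler_wpM2r; first by rewrite mulr_ge0 ?sqr_ge0 ?(ltW i0).
  by rewrite lerXn2r// nnegrE// ltW.
have [m cm1] : exists m, c m <= 1.
  apply/existsP; rewrite -[X in is_true X]negbK negb_exists.
  apply/negP => /forallP h.
  have : \prod_(n < N) (1 : R) < \prod_n c n; last by rewrite c1 big1_eq ltxx.
  apply: ltr_prod.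
    by apply/hasP; exists (Ordinal N0); rewrite ?mem_index_enum.
  by move=> n _; rewrite ler01 ltNge h.
have [k ck1] : exists k, 1 <= c k.
  apply/existsP; rewrite -[X in is_true X]negbK negb_exists.
  apply/negP => /forallP h.
  have : \prod_n c n < \prod_(n < N) (1 : R); last by rewrite c1 big1_eq ltxx.
  apply: ltr_prod.
    by apply/hasP; exists (Ordinal N0); rewrite ?mem_index_enum.
  by move=> n _; rewrite ltW//= ltNge h.
have cle n : c n * beta <= alpha by rewrite -[leRHS]mul1r; exact: (cmp n m).
have cge n : beta <= c n * alpha.
  apply: (@le_trans _ _ (c k * beta)); first by rewrite ler_peMl// ltW.
  by apply: (cmp k n) => //; exact: ltW.
move=> n a; rewrite vE; case/andP: (box n a) => h1 h2; apply/andP; split.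
  rewrite ler_pdivrMr// mulrAC expr2; apply: ler_pM => //; rewrite ?(ltW b0)//.
rewrite ler_pdivlMr// mulrAC expr2; apply: ler_pM => //.
- by rewrite mulr_ge0// ltW.
- exact: ltW.
Qed.

Lemma ln_sub_le (x y : R) : 0 < x -> 0 < y -> y * (ln x - ln y) <= x - y.
Proof.
move=> x0 y0; rewrite -ln_div ?posrE//.
have -> : x - y = y * (x / y - 1) by field; rewrite gt_eqF.
rewrite ler_pM2l// -{1}[x / y](subrK 1) addrC; apply: le_ln1Dx.
by rewrite ltrBrDl subrr divr_gt0.
Qed.

Lemma dist_ln_le (x y : R) : 1 <= x -> 1 <= y -> `|ln x - ln y| <= `|x - y|.
Proof.
move=> x1 y1.
have gen (s t : R) : 1 <= s -> 1 <= t -> ln s - ln t <= `|s - t|.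
  move=> s1 t1; have s0 := lt_le_trans ltr01 s1.
  have t0 := lt_le_trans ltr01 t1.
  have [d0|d0] := leP (ln s - ln t) 0; first by apply: le_trans d0 _.
  apply: le_trans (ler_norm _); apply: le_trans (ln_sub_le s0 t0).
  by rewrite ler_peMl// ltW.
rewrite ler_norml lerNl opprB gen//= andbT distrC; exact: gen.
Qed.

(** With x and y the square roots of s and r, log (x / y) <= x / y - 1 gives
    the lower bound (x - y)^2, and s - r = (x - y) (x + y) with
    (x + y)^2 <= 2 (s + r) <= 4 A. *)
Lemma poisson_divergence_ge (r s A : R) : 1 <= r <= A -> 1 <= s <= A ->
  (s - r) ^+ 2 / (4 * A) <= (s - r) - r * (ln s - ln r).
Proof.
move=> /andP[r1 rA] /andP[s1 sA].
have r0 := lt_le_trans ltr01 r1; have s0 := lt_le_trans ltr01 s1.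
have A0 := lt_le_trans r0 rA.
set x := Num.sqrt s; set y := Num.sqrt r.
have x0 : 0 < x by rewrite sqrtr_gt0.
have y0 : 0 < y by rewrite sqrtr_gt0.
have sx : s = x ^+ 2 by rewrite sqr_sqrtr// ltW.
have ry : r = y ^+ 2 by rewrite sqr_sqrtr// ltW.
have h1 : (x - y) ^+ 2 <= (s - r) - r * (ln s - ln r).
  rewrite sx ry !lnXn// -mulrnBl -mulr_natl.
  have := ler_wpM2l (ltW y0) (ln_sub_le x0 y0).
  move: (ln x - ln y) => l; nra.
apply: le_trans h1; rewrite ler_pdivrMr ?mulr_gt0//.
rewrite sx ry subr_sqr exprMn ler_wpM2l ?sqr_ge0//.
rewrite sx in sA; rewrite ry in rA; have := sqr_ge0 (x - y); nra.
Qed.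

Definition log_gap (T M : tensor R N I) i := ln (T i + 1) - ln (M i + 1).

Lemma outer_bounds u (beta alpha : R) : 0 < beta -> in_box beta alpha u ->
  forall i, 0 < outer u i <= alpha ^+ N.
Proof.
move=> b0 box i; rewrite ffunE.
have u0 n a : 0 < u n a by apply: lt_le_trans b0 _; case/andP: (box n a).
rewrite prodr_gt0//= -[N in leRHS]card_ord -prodr_const; apply: ler_prod => n _.
by rewrite ltW//=; case/andP: (box n (i n)).
Qed.

(** The gain of the estimate over the truth in the objective is nonnegative. It
    is the centred linear term on the right minus Poisson divergences, to which
    [poisson_divergence_ge] applies. *)
Lemma basic_inequality x u w (beta alpha : R) : 0 < beta ->
  in_box beta alpha u -> in_box beta alpha w ->
  is_shifted_poisson_estimate beta alpha x (outer w) ->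
  (\sum_i (outer w i - outer u i) ^+ 2) / (4 * (alpha ^+ N + 1)) <=
    \sum_i log_gap (outer w) (outer u) i * ((x i)%:R - outer u i).
Proof.
move=> b0 bu bw [_ /(_ (outer u))]; move=> /(_ (ex_intro2 _ _ u bu erefl)).
rewrite -subr_ge0 -sumrB => obj.
pose gain i := ((x i)%:R + 1) * ln (outer w i + 1) - (outer w i + 1) -
  (((x i)%:R + 1) * ln (outer u i + 1) - (outer u i + 1)).
rewrite mulr_suml; apply: (@le_trans _ _ (\sum_i
  (log_gap (outer w) (outer u) i * ((x i)%:R - outer u i) - gain i))).
  apply: ler_sum => i _.
  have /andP[u0 u1] := outer_bounds b0 bu i.
  have /andP[w0 w1] := outer_bounds b0 bw i.
  have := @poisson_divergence_ge (outer u i + 1) (outer w i + 1)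
    (alpha ^+ N + 1).
  rewrite !lerD2r u1 w1 !lerDr (ltW u0) (ltW w0) => /(_ isT isT).
  rewrite opprD addrACA subrr addr0 => /le_trans; apply.
  by rewrite le_eqVlt /log_gap /gain; apply/orP; left; apply/eqP; ring.
by rewrite sumrB gerBl.
Qed.

End Deterministic.
(** * Rounding the factors to a grid *)
Section Net.
Context {R : realType} (N I : nat).
Implicit Types (p q u w : 'M[R]_(N, I)).

(** Telescoping, one factor at a time. The base 1 + a, rather than a, keeps the
    powers monotone in the number of factors. *)
Lemma dist_prod_le (J : Type) (s : seq J) (f g : J -> R) (a e : R) :
  0 <= a -> 0 <= e -> (forall j, 0 <= f j <= a) -> (forall j, 0 <= g j <= a) ->
  (forall j, `|f j - g j| <= e) ->
  `|\prod_(j <- s) f j - \prod_(j <- s) g j| <=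
    (size s)%:R * (1 + a) ^+ (size s) * e.
Proof.
move=> a0 e0 fa ga fg.
have a1 : 1 <= 1 + a by rewrite lerDl.
have le_prod (t : seq J) : 0 <= \prod_(j <- t) g j <= (1 + a) ^+ size t.
  elim: t => [|j t /andP[ih0 ih1]]; first by rewrite big_nil ler01 expr0 lexx.
  rewrite big_cons exprS; case/andP: (ga j) => g0 g1; rewrite mulr_ge0//=.
  by rewrite ler_pM// (le_trans g1)// lerDr.
elim: s => [|j s ih]; first by rewrite !big_nil subrr normr0 !mul0r.
rewrite !big_cons (_ : _ - _ = f j * (\prod_(k <- s) f k - \prod_(k <- s) g k) +
  (f j - g j) * \prod_(k <- s) g k); last by ring.
apply: le_trans (ler_normD _ _) _; rewrite !normrM.
case/andP: (fa j) => f0 f1; case/andP: (le_prod s) => g0 g1.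
rewrite (ger0_norm f0) (ger0_norm g0) /= -natr1 mulrDl mul1r mulrDl.
apply: lerD.
  apply: (@le_trans _ _ ((1 + a) * ((size s)%:R * (1 + a) ^+ size s * e))).
    by apply: ler_pM => //; rewrite (le_trans f1)// lerDr.
  by rewrite exprS le_eqVlt; apply/orP; left; apply/eqP; ring.
rewrite mulrC; apply: ler_pM => //; apply: le_trans g1 _.
by rewrite exprS ler_peMl// exprn_ge0// (le_trans ler01).
Qed.

Lemma dist_outer_le p q (beta alpha e : R) : 0 < beta -> 0 <= alpha -> 0 <= e ->
  in_box beta alpha p -> in_box beta alpha q ->
  (forall n a, `|p n a - q n a| <= e) ->
  forall i, `|outer p i - outer q i| <= N%:R * (1 + alpha) ^+ N * e.
Proof.
move=> b0 a0 e0 bp bq pq i; rewrite !ffunE.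
have sN : size (index_enum 'I_N) = N.
  by rewrite [index_enum _]unlock -enumT size_enum_ord.
rewrite -[in leRHS]sN; apply: dist_prod_le => // n.
- by case/andP: (bp n (i n)) => h1 h2; rewrite h2 (le_trans (ltW b0)).
- by case/andP: (bq n (i n)) => h1 h2; rewrite h2 (le_trans (ltW b0)).
Qed.

Definition grid_factors (beta alpha : R) (K : nat) (g : 'M['I_K.+1]_(N, I)) :
    'M[R]_(N, I) :=
  \matrix_(n, a) (beta + (alpha - beta) * ((g n a)%:R / K%:R)).

Lemma grid_factors_box (beta alpha : R) (K : nat) (g : 'M['I_K.+1]_(N, I)) :
  (0 < K)%N -> beta <= alpha -> in_box beta alpha (grid_factors beta alpha g).
Proof.
move=> K0 ba n a; rewrite mxE.
have k0 : 0 < K%:R :> R by rewrite ltr0n.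
rewrite lerDl mulr_ge0 ?subr_ge0 ?divr_ge0//= -lerBrDl.
by rewrite ler_piMr ?subr_ge0// ler_pdivrMr// mul1r ler_nat -ltnS.
Qed.

Lemma grid_factors_dense (beta alpha : R) (K : nat) w :
  (0 < K)%N -> beta < alpha -> in_box beta alpha w ->
  exists g : 'M['I_K.+1]_(N, I),
    forall n a,
      `|w n a - grid_factors beta alpha g n a| <= (alpha - beta) / K%:R.
Proof.
move=> K0 ba bw; have ba0 : 0 < alpha - beta by rewrite subr_gt0.
have k0 : 0 < K%:R :> R by rewrite ltr0n.
pose y n a := (w n a - beta) / (alpha - beta) * K%:R.
have y0 n a : 0 <= y n a.
  case/andP: (bw n a) => h1 _.
  by rewrite mulr_ge0// divr_ge0 ?subr_ge0// ltW.
have yK n a : y n a <= K%:R.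
  case/andP: (bw n a) => _ h2.
  by rewrite ler_piMl// ler_pdivrMr// mul1r lerD2r.
exists (\matrix_(n, a) inord (Num.truncn (y n a))) => n a.
have /andP[t0 t1] := truncn_itv (y0 n a).
have tK : (Num.truncn (y n a) < K.+1)%N.
  by rewrite ltnS -(ler_nat R); exact: le_trans t0 (yK n a).
rewrite !mxE inordK//.
have -> : w n a - (beta + (alpha - beta) * ((Num.truncn (y n a))%:R / K%:R)) =
    (alpha - beta) / K%:R * (y n a - (Num.truncn (y n a))%:R).
  move: ((Num.truncn (y n a))%:R : R) => t; rewrite /y.
  by field; rewrite !gt_eqF.
rewrite ger0_norm; last by rewrite mulr_ge0 ?subr_ge0// divr_ge0// ltW.
rewrite ler_piMr ?divr_ge0 ?(ltW ba0)//.
by rewrite lerBlDl natr1 ltW.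
Qed.

End Net.

(** * Exponential deviations and their mean *)
Section Chernoff.
Context {d : measure_display} {Omega : measurableType d} {R : realType}.
Context (P : probability Omega R) (N I : nat).
Context (X : multi_index N I -> {RV P >-> nat}) (M : tensor R N I) (a : R).
Hypothesis M_bounds : forall i, 0 < M i <= a.
Hypothesis PX : poisson_tensor X M.

(** The mean of exp (l sum_i h_i (x_i - m_i)) is the exponential of the sum of
    m_i (e^(l h_i) - 1 - l h_i), at most 2 m_i (l h_i)^2 by
    [expR_le_quadratic]. *)
Lemma exp_deviation_mean (l : R) (h : multi_index N I -> R) :
  (forall i, l * h i <= 2^-1) ->
  exists2 m, m <= 1 & has_mean P (fun w =>
    expR (l * (\sum_i h i * ((X i w)%:R - M i)) -
      2 * l ^+ 2 * a * \sum_i h i ^+ 2)) m.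
Proof.
move=> lh; have M0 i : 0 < M i by case/andP: (M_bounds i).
have H := has_meanZ (expR (- (2 * l ^+ 2 * a * \sum_i h i ^+ 2)))
  (has_mean_exp M0 PX (fun i => l * h i)).
exists (expR (- (2 * l ^+ 2 * a * \sum_i h i ^+ 2)) *
  expR (\sum_i M i * (expR (l * h i) - 1 - l * h i))).
  rewrite -expRD -[leRHS]expR0 ler_expR addrC subr_le0 mulr_sumr.
  apply: ler_sum => i _; case/andP: (M_bounds i) => m0 ma.
  have := expR_le_quadratic (lh i); rewrite -lerBlDl opprD addrA => q.
  apply: le_trans (ler_wpM2l (ltW m0) q) _.
  rewrite (_ : 2 * l ^+ 2 * a * h i ^+ 2 = a * (2 * (l * h i) ^+ 2)).
    by rewrite ler_wpM2r// mulr_ge0// sqr_ge0.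
  by ring.
apply: has_mean_eq H _ _ => // w /=.
have -> : l * (\sum_i h i * ((X i w)%:R - M i)) =
    \sum_i l * h i * ((X i w)%:R - M i).
  by rewrite mulr_sumr; apply: eq_bigr => i _; rewrite mulrA.
by rewrite -expRD addrC.
Qed.

End Chernoff.

Section Expectation.
Context {d : measure_display} {Omega : measurableType d} {R : realType}.
Context (P : probability Omega R).

Lemma expectation_le_has_mean (f g : Omega -> R) (v : R) :
  measurable_fun setT f -> (forall w, 0 <= f w <= g w) -> has_mean P g v ->
  ('E_P[f] <= v%:E)%E.
Proof.
move=> mf fg [ig <-]; rewrite unlock; apply: ge0_le_integral => //.
- by move=> w _; rewrite lee_fin; case/andP: (fg w).
- exact/measurable_EFinP.
- exact: (measurable_int P).
- by move=> w _; rewrite lee_fin; case/andP: (fg w).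
Qed.

End Expectation.

(** The tangent of the exponential at ln L replaces Jensen's inequality: the
    bound is affine in W, so its expectation is immediate. The points y and W
    are one exponent and the sum of the exponentials over the L grid points. *)
Lemma le_log_mean (R : realType) (y W L : R) : 0 < L -> expR y <= W ->
  y <= ln L + W / L.
Proof.
move=> L0 yW; have := expR_ge1Dx (y - ln L).
rewrite expRD expRN lnK ?posrE// => h.
have : expR y / L <= W / L by rewrite ler_pM2r// invr_gt0.
lra.
Qed.
(** * Mean squared error of the estimated tensor *)
Section Risk.
Context {R : realType} (N I : nat) (beta alpha : R).
Hypotheses (I_gt0 : (0 < I)%N) (beta_gt0 : 0 < beta) (lt_ba : beta < alpha).

(** The constant of the quadratic lower bound in [basic_inequality]. *)
Definition curvature : R := (4 * (alpha ^+ N + 1))^-1.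
(** The parameter l of the exponential moments, chosen so that the compensator
    4 l^2 alpha^N |T - M|^2 takes up half of l * curvature * |T - M|^2. *)
Definition temperature : R := curvature / (8 * alpha ^+ N).
(** With K grid steps, rounding the factors moves no entry of the tensor by
    more than lipschitz / K. *)
Definition lipschitz : R := N%:R * (1 + alpha) ^+ N * (alpha - beta).

Notation grid := 'M['I_(I ^ N).+1]_(N, I).
Notation l := temperature.

Definition gap (u : 'M[R]_(N, I)) (g : grid) :=
  log_gap (outer (grid_factors beta alpha g)) (outer u).

Definition exp_score (u : 'M[R]_(N, I)) (g : grid) (x : tensor nat N I) : R :=
  expR (l * (\sum_i gap u g i * ((x i)%:R - outer u i)) -
    2 * l ^+ 2 * alpha ^+ N * \sum_i gap u g i ^+ 2).

(** The first two terms come from the union over the grid through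
    [le_log_mean], the third is the rounding error in the compensator, the
    last the rounding error in the linear term. *)
Definition risk_bound (u : 'M[R]_(N, I)) (x : tensor nat N I) : R :=
  ln #|{: grid}|%:R + (\sum_g exp_score u g x) / #|{: grid}|%:R +
  4 * l ^+ 2 * alpha ^+ N * lipschitz ^+ 2 +
  l * (lipschitz / (I ^ N)%:R) * \sum_i ((x i)%:R + outer u i).

Lemma alpha_gt0 : 0 < alpha. Proof. exact: lt_trans lt_ba. Qed.

Lemma curvature_gt0 : 0 < curvature.
Proof. by rewrite invr_gt0 mulr_gt0// addr_gt0// exprn_gt0// alpha_gt0. Qed.

Lemma temperature_gt0 : 0 < l.
Proof.
by rewrite divr_gt0 ?curvature_gt0// mulr_gt0// exprn_gt0// alpha_gt0.
Qed.

Lemma lipschitz_ge0 : 0 <= lipschitz.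
Proof.
rewrite mulr_ge0 ?subr_ge0 ?(ltW lt_ba)// mulr_ge0// exprn_ge0// addr_ge0//.
by rewrite ltW// alpha_gt0.
Qed.

Lemma grid_steps_gt0 : (0 < I ^ N)%N. Proof. by rewrite expn_gt0 I_gt0. Qed.

Lemma log_gap_le (T M : tensor R N I) i : 0 < T i -> 0 < M i ->
  `|log_gap T M i| <= `|T i - M i|.
Proof.
move=> T0 M0; have -> : T i - M i = (T i + 1) - (M i + 1) by ring.
by apply: dist_ln_le; rewrite lerDr ltW.
Qed.

Lemma temperature_gap_le u g i : in_box beta alpha u -> l * gap u g i <= 2^-1.
Proof.
move=> bu; have bg := grid_factors_box g grid_steps_gt0 (ltW lt_ba).
have /andP[u0 u1] := outer_bounds beta_gt0 bu i.
have /andP[g0 g1] := outer_bounds beta_gt0 bg i.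
have a0 : 0 < alpha ^+ N by rewrite exprn_gt0// alpha_gt0.
have h : gap u g i <= alpha ^+ N.
  apply: le_trans (ler_norm _) _; apply: le_trans (log_gap_le g0 u0) _.
  by rewrite ler_norml; apply/andP; split; lra.
apply: le_trans (ler_wpM2l (ltW temperature_gt0) h) _.
have -> : l * alpha ^+ N = (32 * (alpha ^+ N + 1))^-1.
  rewrite /temperature /curvature.
  by field; rewrite ?gt_eqF// addr_gt0.
by rewrite lef_pV2 ?posrE ?mulr_gt0 ?addr_gt0//; lra.
Qed.

(** The rounded factors g need not be known: their exponential is one term of
    the sum over the grid. *)
Lemma loss_le_risk_bound u w x : in_box beta alpha u -> in_box beta alpha w ->
  is_shifted_poisson_estimate beta alpha x (outer w) ->
  l * curvature / 2 * (\sum_i (outer w i - outer u i) ^+ 2) <= risk_bound u x.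
Proof.
move=> bu bw est.
have K0 := grid_steps_gt0; set K := (I ^ N)%N in K0 *.
have k0 : 0 < K%:R :> R by rewrite ltr0n.
have a0 : 0 < alpha ^+ N by rewrite exprn_gt0// alpha_gt0.
have l0 := temperature_gt0; have L0 := lipschitz_ge0.
have [g gw] := grid_factors_dense K0 lt_ba bw.
have bg := grid_factors_box g K0 (ltW lt_ba).
set T := outer w; set T' := outer (grid_factors beta alpha g); set M := outer u.
have T0 i : 0 < T i by case/andP: (outer_bounds beta_gt0 bw i).
have T'0 i : 0 < T' i by case/andP: (outer_bounds beta_gt0 bg i).
have M0 i : 0 < M i by case/andP: (outer_bounds beta_gt0 bu i).
pose eta := lipschitz / K%:R.
have eta0 : 0 <= eta by rewrite divr_ge0// ltW.
have TT' i : `|T i - T' i| <= eta.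
  rewrite /eta /lipschitz -mulrA.
  apply: (dist_outer_le beta_gt0) bw bg _ _ => //.
  - exact: ltW alpha_gt0.
  - by rewrite divr_ge0 ?subr_ge0 ?(ltW lt_ba) ?(ltW k0).
set Y := \sum_i (T i - M i) ^+ 2.
(* replace the logarithms at T by those at the rounded T' *)
have step1 : Y * curvature <= \sum_i gap u g i * ((x i)%:R - M i) +
    eta * \sum_i ((x i)%:R + M i).
  apply: le_trans (basic_inequality beta_gt0 bu bw est) _.
  rewrite mulr_sumr -big_split /=; apply: ler_sum => i _.
  rewrite -lerBlDl -mulrBl -/T -/M.
  have -> : log_gap T M i - gap u g i = log_gap T T' i.
    by rewrite /gap /log_gap -/T'; ring.
  apply: le_trans (ler_norm _) _; rewrite normrM; apply: ler_pM => //.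
    exact: le_trans (log_gap_le (T0 i) (T'0 i)) (TT' i).
  rewrite ler_norml; have := M0 i; have : 0 <= (x i)%:R :> R by [].
  by move=> ? ?; apply/andP; split; lra.
(* the compensator at T' is controlled by the loss at T *)
have step2 : \sum_i gap u g i ^+ 2 <= 2 * Y + 2 * (K%:R * eta ^+ 2).
  have -> : K%:R * eta ^+ 2 = \sum_(i : multi_index N I) eta ^+ 2.
    by rewrite sumr_const card_ffun !card_ord mulr_natl.
  rewrite !mulr_sumr -big_split /=; apply: ler_sum => i _.
  apply: (@le_trans _ _ ((T' i - M i) ^+ 2)).
    rewrite -[leLHS]real_normK ?num_real// -[leRHS]real_normK ?num_real//.
    by rewrite lerXn2r// ?nnegrE//; exact: log_gap_le.
  have : (T i - T' i) ^+ 2 <= eta ^+ 2.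
    by rewrite -real_normK ?num_real// lerXn2r// ?nnegrE.
  have := sqr_ge0 (T i - M i + (T i - T' i)); nra.
have step3 : l * (\sum_i gap u g i * ((x i)%:R - M i)) -
    2 * l ^+ 2 * alpha ^+ N * (\sum_i gap u g i ^+ 2) <=
    ln #|{: grid}|%:R + (\sum_g exp_score u g x) / #|{: grid}|%:R.
  apply: le_log_mean.
    by rewrite ltr0n; apply/card_gt0P; exists g.
  rewrite [leRHS](bigD1 g)//= lerDl; apply: sumr_ge0 => g' _; exact: expR_ge0.
(* the choice of l: half of the quadratic term remains on the left *)
have lc : 4 * l ^+ 2 * alpha ^+ N = l * curvature / 2.
  have <- : l * alpha ^+ N * 8 = curvature.
    by rewrite /temperature; field; rewrite gt_eqF.
  by move: (alpha ^+ N) temperature => y z; field.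
have step4 : K%:R * eta ^+ 2 <= lipschitz ^+ 2.
  rewrite /eta (_ : K%:R * _ = lipschitz ^+ 2 / K%:R); last first.
    by field; rewrite gt_eqF.
  by rewrite ler_piMr ?exprn_ge0// invf_le1// ler1n.
rewrite /risk_bound -/K -/eta -/M.
have {}step1 := ler_wpM2l (ltW l0) step1.
have kla0 (k : nat) : 0 <= k%:R * l ^+ 2 * alpha ^+ N :=
  mulr_ge0 (mulr_ge0 (ler0n R k) (exprn_ge0 2 (ltW l0))) (ltW a0).
have {}step2 := ler_wpM2l (kla0 2) step2.
have {}step4 := ler_wpM2l (kla0 4) step4.
have e1 : l * (Y * curvature) - 4 * l ^+ 2 * alpha ^+ N * Y =
    l * curvature / 2 * Y.
  by rewrite lc; field.
move: step1 step2 step3 step4 e1.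
move: (l ^+ 2) (\sum_i gap u g i * _) (\sum_i gap u g i ^+ 2) (ln _)
  (_ / #|{: grid}|%:R) (\sum_i ((x i)%:R + M i)) (alpha ^+ N) (K%:R * _)
  (lipschitz ^+ 2) => l2 Z H lnL W S a k e.
rewrite mulrDr => s1 s2 s3 s4 <-.
nra.
Qed.

Context {d : measure_display} {Omega : measurableType d}.
Context (P : probability Omega R).

Definition risk_const : R := 1 + 4 * l ^+ 2 * alpha ^+ N * lipschitz ^+ 2 +
  2 * l * lipschitz * alpha ^+ N.

Lemma has_mean_risk_bound u (X : multi_index N I -> {RV P >-> nat}) :
  in_box beta alpha u -> poisson_tensor X (outer u) ->
  exists2 m, m <= ln #|{: grid}|%:R + risk_const &
    has_mean P (fun w => risk_bound u (observed X w)) m.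
Proof.
move=> bu PX.
have bM := outer_bounds beta_gt0 bu.
have M0 i : 0 < outer u i by case/andP: (bM i).
have k0 : 0 < (I ^ N)%:R :> R by rewrite ltr0n grid_steps_gt0.
have l0 := temperature_gt0; have L0 := lipschitz_ge0.
have card0 : 0 < #|{: grid}|%:R :> R.
  by rewrite ltr0n; apply/card_gt0P; exists (const_mx ord0).
have /choice[m Hm] g : exists m, m <= 1 /\
    has_mean P (fun w => exp_score u g (observed X w)) m.
  have [m m1 Hm] := exp_deviation_mean bM PX
    (fun i => temperature_gap_le g i bu).
  exists m; split; [exact: m1|apply: has_mean_eq Hm _ erefl => w].
  by rewrite /exp_score; under [in RHS]eq_bigr do rewrite [observed X w _]ffunE.
have Hexp := has_meanZ (#|{: grid}|%:R)^-1
  (has_mean_sum (index_enum _) (fun g => (Hm g).2)).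
have Hcount := has_meanZ (l * (lipschitz / (I ^ N)%:R))
  (has_mean_sum (index_enum _) (fun i =>
     has_meanD (has_mean_count M0 PX i) (has_mean_cst P (outer u i)))).
have H := has_meanD (has_meanD (has_meanD
    (has_mean_cst P (ln #|{: grid}|%:R)) Hexp)
  (has_mean_cst P (4 * l ^+ 2 * alpha ^+ N * lipschitz ^+ 2))) Hcount.
eexists; last first.
  apply: has_mean_eq H _ erefl => w /=.
  rewrite /risk_bound; congr (_ + _ + _ + _ * _); first by rewrite mulrC.
  by apply: eq_bigr => i _; rewrite [observed X w i]ffunE.
rewrite /risk_const /= !addrA; apply: lerD.
  rewrite lerD2r lerD2l mulrC ler_pdivrMr// mul1r.
  apply: le_trans (ler_sum _ (fun g _ => (Hm g).1)) _.
  by rewrite sumr_const.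
apply: (@le_trans _ _ (l * (lipschitz / (I ^ N)%:R) *
    (2 * alpha ^+ N * (I ^ N)%:R))).
  apply: ler_wpM2l; first exact: mulr_ge0 (ltW l0) (divr_ge0 L0 (ltW k0)).
  have -> : 2 * alpha ^+ N * (I ^ N)%:R =
      \sum_(i : multi_index N I) 2 * alpha ^+ N.
    by rewrite sumr_const card_ffun !card_ord mulr_natr.
  by apply: ler_sum => i _; have /andP[_ h] := bM i; lra.
by rewrite le_eqVlt; apply/orP; left; apply/eqP; field; rewrite gt_eqF.
Qed.

End Risk.
(** * Both bounds, with their dependence on I *)
Section Assembly.
Context {R : realType}.

Lemma exprz_subn2 (x : R) (N : nat) : x != 0 ->
  x ^ (N%:Z - 2%:Z) = x ^+ N / x ^+ 2.
Proof. by move=> x0; rewrite expfzDr// -exprnP -exprnN. Qed.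

Lemma norm2_mxvecB (N I : nat) (p q : 'M[R]_(N, I)) :
  norm2 (mxvec p - mxvec q) ^+ 2 = \sum_n \sum_a (p n a - q n a) ^+ 2.
Proof.
rewrite /norm2 sqr_sqrtr; last by apply: sumr_ge0 => j _; exact: sqr_ge0.
rewrite sum_mxvec; apply: eq_bigr => n _; apply: eq_bigr => a _.
by rewrite !mxE !mxvecE.
Qed.

Lemma fisher_trace_bound (N I : nat) (beta alpha : R) (d : measure_display)
    (Omega : measurableType d) (P : probability Omega R) (u : 'M[R]_(N, I))
    (X : multi_index N I -> {RV P >-> nat}) :
  (0 < N)%N -> (0 < I)%N -> 0 < beta -> in_box beta alpha u ->
  poisson_tensor X (outer u) ->
  `|\tr (pseudo_inverse (fisher_information X (mxvec u)))| <=
    2 * N%:R * alpha ^+ 2 / beta ^+ N * (1 / I%:R ^ (N%:Z - 2%:Z)).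
Proof.
move=> N0 I0 b0 bu PX.
have u0 n a : 0 < u n a by apply: lt_le_trans b0 _; case/andP: (bu n a).
have FE n a n' b : fisher_information X (mxvec u)
    (mxvec_index n a) (mxvec_index n' b) = fisher_entry u n a n' b.
  by rewrite fisher_informationE// sum_fisher_entry.
apply: le_trans (norm_trace_pseudo_inverse_le (fisher_sym FE)
  (fisher_ginvP u0 I0 FE N0)) _.
rewrite exprz_subn2 ?pnatr_eq0 -?lt0n// mul1r invf_div.
exact: sum_norm_fisher_ginv_le.
Qed.

Definition conversion_const (N : nat) (beta alpha : R) : R :=
  let b := beta ^+ 2 / alpha in let a := alpha ^+ 2 / beta in
  N%:R * (1 + 2 * a / b) / b ^+ (2 * N.-1).

Lemma conversion_const_ge0 (N : nat) (beta alpha : R) :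
  0 <= beta -> 0 <= alpha -> 0 <= conversion_const N beta alpha.
Proof.
move=> b0 a0; rewrite /conversion_const.
have A0 : 0 <= alpha ^+ 2 / beta by rewrite divr_ge0// sqr_ge0.
have B0 : 0 <= beta ^+ 2 / alpha by rewrite divr_ge0// sqr_ge0.
apply: divr_ge0; last exact: exprn_ge0.
apply: mulr_ge0 => //; apply: addr_ge0 => //; apply: divr_ge0 => //.
exact: mulr_ge0.
Qed.

(** Rescaling leaves the tensors unchanged, so [balanced_factors_le] applies to
    the balanced factors of both tensors, in the enlarged box of
    [balanced_rescaling_box]. *)
Lemma factor_error_le (N I : nat) (beta alpha : R) (u v w t : 'M[R]_(N, I)) :
  (0 < N)%N -> (0 < I)%N -> 0 < beta -> 0 < alpha ->
  in_box beta alpha u -> in_box beta alpha w ->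
  balanced_rescaling u v -> balanced_rescaling w t ->
  norm2 (mxvec t - mxvec v) ^+ 2 <= conversion_const N beta alpha *
    ((\sum_i (outer w i - outer u i) ^+ 2) / I%:R ^+ N.-1).
Proof.
move=> N0 I0 b0 a0 bu bw uv wt.
have bv := balanced_rescaling_box N0 I0 b0 bu uv.
have bt := balanced_rescaling_box N0 I0 b0 bw wt.
case: uv => _ <- nv; case: wt => _ <- nt.
rewrite norm2_mxvecB; apply: balanced_factors_le => //.
by rewrite divr_gt0// exprn_gt0.
Qed.

Lemma ln_net_card_le (N I : nat) : (0 < N)%N -> (1 < I)%N ->
  ln (#|{: 'M['I_(I ^ N).+1]_(N, I)}|%:R : R) <=
    N%:R * N.+1%:R * (I%:R * ln I%:R).
Proof.
move=> N0 I1; rewrite card_mx card_ord natrX lnXn ?ltr0n//.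
have i0 : 0 < I%:R :> R by rewrite ltr0n ltnW.
rewrite -[ln _ *+ _]mulr_natl natrM -!mulrA; apply: ler_wpM2l => //.
rewrite [leRHS]mulrCA; apply: ler_wpM2l => //; rewrite mulr_natl -lnXn//.
rewrite ler_ln ?posrE ?ltr0n ?exprn_gt0// -natrX ler_nat expnS.
apply: (@leq_trans (2 * I ^ N)); last by rewrite leq_mul2r I1 orbT.
by rewrite mul2n -addnn -addn1 leq_add2l expn_gt0 ltnW.
Qed.

(** For I >= 2 the ratio ln I / ln 2 is at least 1; its powers bring both terms
    to the order I (ln I)^2. *)
Lemma ln_risk_le (N I : nat) (c : R) : (0 < N)%N -> (1 < I)%N -> 0 <= c ->
  ln (#|{: 'M['I_(I ^ N).+1]_(N, I)}|%:R : R) + c <=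
    (N%:R * N.+1%:R / ln 2 + c / ln 2 ^+ 2) * (I%:R * ln I%:R ^+ 2).
Proof.
move=> N0 I1 c0.
have l2 : 0 < ln 2 :> R by rewrite ln_gt0// ltr1n.
have i1 : 1 <= I%:R :> R by rewrite ler1n ltnW.
have lI : ln 2 <= ln I%:R :> R.
  by rewrite ler_ln ?posrE ?ltr0n ?ler_nat// ltnW.
rewrite mulrDl; apply: lerD.
  apply: le_trans (ln_net_card_le N0 I1) _.
  rewrite -[leRHS]mulrA; apply: ler_wpM2l; first exact: mulr_ge0.
  rewrite [leRHS]mulrCA; apply: ler_wpM2l => //.
  rewrite [leRHS]mulrC ler_pdivlMr// expr2; apply: ler_wpM2l => //.
  exact: le_trans (ltW l2) lI.
rewrite -mulrA ler_peMr// [leRHS]mulrC ler_pdivlMr ?exprn_gt0// mul1r.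
apply: (@le_trans _ _ (ln I%:R ^+ 2)).
  by rewrite lerXn2r// nnegrE ?(le_trans (ltW l2))// ltW.
by rewrite ler_peMl// sqr_ge0.
Qed.

End Assembly.
Theorem theorem3 (R : realType) :
  (forall (N : nat) (beta alpha : R),
     (0 < N)%N -> 0 < beta -> beta <= alpha ->
     exists K : R,
     forall (I : nat) (d : measure_display) (Omega : measurableType d)
       (P : probability Omega R) (u : 'M[R]_(N, I))
       (X : multi_index N I -> {RV P >-> nat}),
       (0 < I)%N ->
       in_box beta alpha u ->
       poisson_tensor X (outer u) ->
       `| \tr (pseudo_inverse (fisher_information X (mxvec u))) |
         <= K * (1 / I%:R ^ (N%:Z - 2%:Z)))
  /\
  (exists C1 C3 : R, [/\ 0 < C1, 0 < C3 &
   forall (N : nat) (beta alpha : R),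
     (0 < N)%N -> 0 < beta -> beta <= alpha ->
     exists K : R,
     forall (I : nat) (d : measure_display) (Omega : measurableType d)
       (P : probability Omega R) (u : 'M[R]_(N, I))
       (X : multi_index N I -> {RV P >-> nat})
       (v : 'M[R]_(N, I))
       (Mt : tensor nat N I -> tensor R N I)
       (wt vt : tensor nat N I -> 'M[R]_(N, I)),
       (0 < I)%N ->
       in_box beta alpha u ->
       poisson_tensor X (outer u) ->
       balanced_rescaling u v ->
       (forall x, is_shifted_poisson_estimate beta alpha x (Mt x)) ->
       (forall x, in_box beta alpha (wt x) /\ Mt x = outer (wt x)) ->
       (forall x, balanced_rescaling (wt x) (vt x)) ->
       (beta ^+ N + 1) ^+ 2 * beta ^+ (2 * (N - 1)) * (alpha - beta) ^+ 2
         / (C3 * (alpha ^+ N + 1) ^+ 4)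
         <= I%:R * N%:R ^+ 3 * ln (I%:R : R) ^+ 2 ->
       ln (I%:R : R) <= C1 * I%:R * ln N%:R ->
       ('E_P[fun w : Omega =>
           (norm2 (mxvec (vt (observed X w)) - mxvec v) ^+ 2)%R]
         <= (K * (ln (I%:R : R) ^+ 2 / I%:R ^ (N%:Z - 2%:Z)))%:E)%E]).
Proof.
split.
  move=> N beta alpha N0 b0 ba; exists (2 * N%:R * alpha ^+ 2 / beta ^+ N).
  move=> I d Omega P u X I0 bu PX; exact: fisher_trace_bound.
exists 1, 1; split => // N beta alpha N0 b0 ba.
have a0 : 0 < alpha := lt_le_trans b0 ba.
(* the box is a point: the estimate is exact *)
have [ba_eq|ne] := eqVneq beta alpha.
  exists 0 => I d Omega P u X v Mt wt vt I0 bu PX uv est wtP vtP _ _.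
  rewrite mul0r; have box1 w : in_box beta alpha w -> w = const_mx beta.
    move=> bw; apply/matrixP => n a; rewrite mxE; apply/eqP.
    by rewrite eq_le andbC {2}ba_eq; exact: bw.
  have err0 x : norm2 (mxvec (vt x) - mxvec v) ^+ 2 = 0.
    apply/eqP; rewrite eq_le sqr_ge0 andbT.
    have [bw _] := wtP x.
    apply: le_trans (factor_error_le N0 I0 b0 a0 bu bw uv (vtP x)) _.
    rewrite (box1 _ _ _ bu) (box1 _ _ _ bw) big1 ?mul0r ?mulr0// => i _.
    by rewrite subrr expr0n.
  by rewrite unlock; under eq_integral do rewrite err0; rewrite integral0.
have lt_ba : beta < alpha by rewrite lt_neqAle ne.
pose l := temperature N alpha; pose c := curvature N alpha.
have l0 : 0 < l by exact: (temperature_gt0 N b0 lt_ba).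
have c0 : 0 < c by exact: (curvature_gt0 N b0 lt_ba).
have lc0 : 0 < l * c / 2 := divr_gt0 (mulr_gt0 l0 c0) (ltr0n R 2).
pose D := conversion_const N beta alpha * (l * c / 2)^-1.
have D0 : 0 <= D.
  apply: mulr_ge0; first by apply: conversion_const_ge0; exact: ltW.
  by rewrite invr_ge0 ltW.
pose r := risk_const N beta alpha.
have r0 : 0 <= r.
  have an0 : 0 <= alpha ^+ N by rewrite exprn_ge0// ltW.
  have L0 := lipschitz_ge0 N b0 lt_ba.
  apply: addr_ge0; last first.
    exact: mulr_ge0 (mulr_ge0 (mulr_ge0 (ler0n R 2) (ltW l0)) L0) an0.
  apply: addr_ge0 => //; apply: mulr_ge0; last exact: exprn_ge0.
  exact: mulr_ge0 (mulr_ge0 (ler0n R 4) (exprn_ge0 2 (ltW l0))) an0.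
exists (D * (N%:R * N.+1%:R / ln 2 + r / ln 2 ^+ 2)).
move=> I d Omega P u X v Mt wt vt I0 bu PX uv est wtP vtP large _.
have [I1|I1] := leqP I 1.
  (* ln 1 = 0, so the lower bound on I fails when beta < alpha *)
  have I_1 : I = 1%N by apply/eqP; rewrite eqn_leq I1 I0.
  exfalso; move: large; rewrite I_1 ln1 expr0n /= mulr0 leNgt => /negP; apply.
  have ba0 : 0 < alpha - beta by rewrite subr_gt0.
  have pow1_gt0 (y : R) k : 0 < y -> 0 < (y ^+ N + 1) ^+ k.
    by move=> y0; rewrite exprn_gt0// addr_gt0// exprn_gt0.
  rewrite mul1r; apply: divr_gt0; last exact: pow1_gt0.
  apply: mulr_gt0; last exact: exprn_gt0.
  by apply: mulr_gt0; [exact: pow1_gt0|exact: exprn_gt0].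
have i0 : 0 < I%:R :> R by rewrite ltr0n.
have [m m_le Hm] := has_mean_risk_bound I0 b0 lt_ba bu PX.
pose J : R := I%:R ^+ N.-1.
have J0 : 0 < J by rewrite exprn_gt0.
apply: le_trans (expectation_le_has_mean _ _ (has_meanZ (D / J) Hm)) _.
- exact: (measurable_observed X (fun x => norm2 (mxvec (vt x) - mxvec v) ^+ 2)).
- move=> w; rewrite sqr_ge0 /=; set x := observed X w.
  have [bw MtE] := wtP x.
  apply: le_trans (factor_error_le N0 I0 b0 a0 bu bw uv (vtP x)) _.
  have estx := est x; rewrite MtE in estx.
  have loss := loss_le_risk_bound I0 b0 lt_ba bu bw estx.
  have reorder (q y : R) :
      q * (l * c / 2)^-1 / J * y = q * (y / (l * c / 2) / J).
    by field; rewrite !gt_eqF.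
  rewrite /D reorder; apply: ler_wpM2l.
    by apply: conversion_const_ge0; exact: ltW.
  apply: ler_wpM2r; first by rewrite invr_ge0 ltW.
  by rewrite ler_pdivlMr// mulrC.
rewrite lee_fin.
have m_le' := le_trans m_le (ln_risk_le N0 I1 r0).
apply: le_trans (ler_wpM2l _ m_le') _; first by rewrite divr_ge0// ltW.
rewrite exprz_subn2 ?gt_eqF// le_eqVlt; apply/orP; left; apply/eqP.
have -> : I%:R ^+ N = I%:R * J :> R by rewrite -exprS prednK.
have ln20 : ln 2 != 0 :> R by rewrite gt_eqF// ln_gt0// ltr1n.
by field; rewrite ln20 !gt_eqF.
Qed.
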